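(* Let $X$ be a locally path connected compact metric space, let $n\ge 1$ be an integer and let $M>0$. Then, for any $\epsilon>0$ and any finite subset $\mathcal F\subset C(X)$, there exist $\delta>0$ and a finite subset $\mathcal G\subset C(X)$ satisfying the following: for any unital map $\phi: C(X)\to C([0,1],M_n)$ (not assumed linear) with $\|\phi(f)\|\le M$ for all $f\in C(X)$ with $\|f\|\le 1$ such that $$\|\phi(\lambda_1 x+\lambda_2 y)-(\lambda_1\phi(x)+\lambda_2\phi(y))\|<\delta,\quad \|\phi(xy)-\phi(x)\phi(y)\|<\delta\quad\text{and}\quad\|\phi(x^* )-\phi(x)^*\|<\delta$$ for all $\lambda_1,\lambda_2\in\mathbb C$ with $|\lambda_i|\le 1$ ($i=1,2$) and all $x,y\in\mathcal G$, there exists a unital homomorphism $\psi: C(X)\to C([0,1],M_n)$ such that $$\|\phi(f)-\psi(f)\|<\epsilon\quad\text{for all } f\in\mathcal F.$$ If, moreover, $\pi_0\circ\phi$ is a unital homomorphism, then $\psi$ can be chosen so that $\pi_0\circ\psi=\pi_0\circ\phi$; and if both $\pi_0\circ\phi$ and $\pi_1\circ\phi$ are unital homomorphisms, then $\psi$ can be chosen so that $\pi_0\circ\psi=\pi_0\circ\phi$ and $\pi_1\circ\psi=\pi_1\circ\phi$.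
   Context: $M_n$ is the $C^*$-algebra of $n\times n$ complex matrices; homomorphisms are $*$-homomorphisms; a unital map is one sending $1$ to $1$. For $t\in[0,1]$, $\pi_t: C([0,1],M_n)\to M_n$ denotes the point evaluation $\pi_t(f)=f(t)$. *)

(* Defs.v *)
From HB Require Import structures.
From mathcomp Require Import all_boot all_order all_algebra.
From mathcomp Require Import all_classical all_reals all_analysis.
From mathcomp Require Import homotopy complex.

Set Implicit Arguments.
Unset Strict Implicit.
Unset Printing Implicit Defensive.

Import Order.TTheory GRing.Theory Num.Theory.
Import numFieldNormedType.Exports.

Local Open Scope classical_set_scope.
Local Open Scope ring_scope.

HB.mixin Record isTopologicalPzRing A
    & TopologicalZmodule A & GRing.PzRing A := {
  mul_continuous : continuous (fun xy : A * A => xy.1 * xy.2) }.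

#[short(type="topologicalPzRingType")]
HB.structure Definition TopologicalPzRing :=
  {A of TopologicalZmodule A & GRing.PzRing A & isTopologicalPzRing A}.

(* Pointwise operations on continuous functions; T may be empty, in which case
   the function ring is trivial, hence the use of pzRingType. *)
Section continuous_zmod.
Context {T : topologicalType} {A : topologicalZmodType}.
Implicit Types f g h : continuousType T A.

Lemma cts_zero_continuous : continuous (cst 0 : T -> A).
Proof. by move=> x; exact: cvg_cst. Qed.

Lemma cts_opp_continuous f : continuous (fun x => - f x).
Proof.
move=> x; apply: (@continuous_comp _ _ _ f (-%R : A -> A)).
  exact: cts_fun.
exact: opp_continuous.
Qed.

Lemma cts_add_continuous f g : continuous (fun x => f x + g x).
Proof.
move=> x.
apply: (@continuous_comp _ _ _ (fun x => (f x, g x)) (fun z : A * A => z.1 + z.2)).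
  by apply: cvg_pair; exact: cts_fun.
exact: add_continuous.
Qed.

Definition cts_zero : continuousType T A := mkcts cts_zero_continuous.
Definition cts_opp f : continuousType T A := mkcts (@cts_opp_continuous f).
Definition cts_add f g : continuousType T A := mkcts (@cts_add_continuous f g).

Lemma cts_addA : associative cts_add.
Proof. by move=> f g h; apply/continuousEP => x; exact: addrA. Qed.
Lemma cts_addC : commutative cts_add.
Proof. by move=> f g; apply/continuousEP => x; exact: addrC. Qed.
Lemma cts_add0 : left_id cts_zero cts_add.
Proof. by move=> f; apply/continuousEP => x; exact: add0r. Qed.
Lemma cts_addN : left_inverse cts_zero cts_opp cts_add.
Proof. by move=> f; apply/continuousEP => x; exact: addNr. Qed.

HB.instance Definition _ := GRing.isZmodule.Build (continuousType T A)
  cts_addA cts_addC cts_add0 cts_addN.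
End continuous_zmod.

Section continuous_lmod.
Context {K : numFieldType} {T : topologicalType} {A : topologicalLmodType K}.
Implicit Types f g : continuousType T A.

Lemma cts_scale_continuous (a : K) f : continuous (fun x => a *: f x).
Proof.
move=> x; have aE : (fun _ : T => a : K^o) @ x --> (a : K^o) by exact: cvg_cst.
exact: (continuous_comp (cvg_pair aE (@cts_fun _ _ f x))
                        (@scale_continuous K A (a : K^o, f x))).
Qed.

Definition cts_scale (a : K) f : continuousType T A :=
  mkcts (@cts_scale_continuous a f).

Lemma cts_scaleA a b f : cts_scale a (cts_scale b f) = cts_scale (a * b) f.
Proof. by apply/continuousEP => x; exact: scalerA. Qed.
Lemma cts_scale1 : left_id 1 cts_scale.
Proof. by move=> f; apply/continuousEP => x; exact: scale1r. Qed.
Lemma cts_scaleDr : right_distributive cts_scale +%R.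
Proof. by move=> a f g; apply/continuousEP => x; exact: scalerDr. Qed.
Lemma cts_scaleDl f : {morph cts_scale^~ f : a b / a + b}.
Proof. by move=> a b; apply/continuousEP => x; exact: scalerDl. Qed.

HB.instance Definition _ := GRing.Zmodule_isLmodule.Build K (continuousType T A)
  cts_scaleA cts_scale1 cts_scaleDr cts_scaleDl.
End continuous_lmod.

Section continuous_ring.
Context {T : topologicalType} {A : topologicalPzRingType}.
Implicit Types f g h : continuousType T A.

Lemma cts_one_continuous : continuous (cst 1 : T -> A).
Proof. by move=> x; exact: cvg_cst. Qed.

Lemma cts_mul_continuous f g : continuous (fun x => f x * g x).
Proof.
move=> x.
apply: (@continuous_comp _ _ _ (fun x => (f x, g x)) (fun z : A * A => z.1 * z.2)).
  by apply: cvg_pair; exact: cts_fun.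
exact: mul_continuous.
Qed.

Definition cts_one : continuousType T A := mkcts cts_one_continuous.
Definition cts_mul f g : continuousType T A := mkcts (@cts_mul_continuous f g).

Lemma cts_mulA : associative cts_mul.
Proof. by move=> f g h; apply/continuousEP => x; exact: mulrA. Qed.
Lemma cts_mul1l : left_id cts_one cts_mul.
Proof. by move=> f; apply/continuousEP => x; exact: mul1r. Qed.
Lemma cts_mul1r : right_id cts_one cts_mul.
Proof. by move=> f; apply/continuousEP => x; exact: mulr1. Qed.
Lemma cts_mulDl : left_distributive cts_mul +%R.
Proof. by move=> f g h; apply/continuousEP => x; exact: mulrDl. Qed.
Lemma cts_mulDr : right_distributive cts_mul +%R.
Proof. by move=> f g h; apply/continuousEP => x; exact: mulrDr. Qed.

HB.instance Definition _ := GRing.Zmodule_isPzRing.Build (continuousType T A)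
  cts_mulA cts_mul1l cts_mul1r cts_mulDl cts_mulDr.
End continuous_ring.

Section matrix_algebra.
Variable K : numClosedFieldType.

Lemma regular_mul_continuous : continuous (fun xy : K^o * K^o => xy.1 * xy.2).
Proof. exact: (@scale_continuous K K^o). Qed.

HB.instance Definition _ := isTopologicalPzRing.Build K^o regular_mul_continuous.

(* The topology of K is carried by its alias K^o. *)
Definition conjo (z : K^o) : K^o := Num.conj z.

Lemma conjo_continuous : continuous conjo.
Proof.
move=> x U /nbhs_ballP[e e0 xeU]; apply/nbhs_ballP; exists e => // y.
by rewrite /ball /= -norm_conjC rmorphB => xy; exact: xeU.
Qed.

HB.instance Definition _ := isContinuous.Build K^o K^o conjo conjo_continuous.

Lemma mx_continuous (T : topologicalType) m p (F : T -> 'M[K^o]_(m, p)) :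
  (forall i j, continuous (fun t => F t i j : K^o)) -> continuous F.
Proof.
move=> Fc x; apply/cvg_ballP => e e0.
have H : \forall t \near x, forall i j, ball (F x i j : K^o) e (F t i j : K^o).
  apply: filter_forall => i; apply: filter_forall => j.
  exact: (Fc i j x _ (nbhsx_ballx _ _ e0)).
by near=> t; split=> // i j; move: i j; near: t.
Unshelve. all: by end_near. Qed.

Lemma mxring_mul_continuous n :
  continuous (fun xy : 'M[K^o]_n * 'M[K^o]_n => xy.1 * xy.2).
Proof.
apply: mx_continuous => i j.
have -> : (fun xy : 'M[K^o]_n * 'M[K^o]_n => (xy.1 * xy.2) i j : K^o) =
    \sum_k (fun xy : 'M[K^o]_n * 'M[K^o]_n => xy.1 i k * xy.2 k j : K^o).
  by apply/funext => xy; rewrite fct_sumE mxE.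
elim/big_ind: _ => [x|f g fc gc x|k _ x]; first exact: cvg_cst.
  exact: (@cvgD K K^o _ _ _ f g _ _ (fc x) (gc x)).
have c1 : (fun xy : 'M[K^o]_n * 'M[K^o]_n => xy.1 i k : K^o) @ x -->
    (x.1 i k : K^o).
  apply: (@continuous_comp _ _ _ fst (fun M : 'M[K^o]_n => M i k : K^o)).
    exact: cvg_fst.
  exact: coord_continuous.
have c2 : (fun xy : 'M[K^o]_n * 'M[K^o]_n => xy.2 k j : K^o) @ x -->
    (x.2 k j : K^o).
  apply: (@continuous_comp _ _ _ snd (fun M : 'M[K^o]_n => M k j : K^o)).
    exact: cvg_snd.
  exact: coord_continuous.
exact: (continuous_comp (cvg_pair c1 c2)
                        (@regular_mul_continuous (x.1 i k, x.2 k j))).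
Qed.

HB.instance Definition _ n :=
  isTopologicalPzRing.Build 'M[K^o]_n (@mxring_mul_continuous n).

Definition adjmx n (A : 'M[K^o]_n) : 'M[K^o]_n := (map_mx Num.conj A)^T.

Lemma adjmx_continuous n : continuous (@adjmx n).
Proof.
apply: mx_continuous => i j.
have -> : (fun A : 'M[K^o]_n => adjmx A i j : K^o) =
    conjo \o (fun A : 'M[K^o]_n => A j i : K^o).
  by apply/funext => A; rewrite /adjmx !mxE.
move=> x; apply: continuous_comp; first exact: coord_continuous.
exact: conjo_continuous.
Qed.

HB.instance Definition _ n :=
  isContinuous.Build 'M[K^o]_n 'M[K^o]_n (@adjmx n) (@adjmx_continuous n).
End matrix_algebra.

Section unit_interval.
Variable R : realType.

Definition unitI : Type := set_type (`[0, 1]%classic : set R).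

HB.instance Definition _ := PseudoMetric.copy unitI (set_type (`[0, 1]%classic : set R)).

Lemma unitI_mem0 : (0 : R) \in (`[0, 1]%classic : set R).
Proof. by rewrite inE /= in_itv /= lexx ler01. Qed.

Lemma unitI_mem1 : (1 : R) \in (`[0, 1]%classic : set R).
Proof. by rewrite inE /= in_itv /= lexx ler01. Qed.

Definition unitI0 : unitI := SigSub unitI_mem0.
Definition unitI1 : unitI := SigSub unitI_mem1.

Lemma unitI0_neq1 : unitI0 != unitI1.
Proof. by rewrite -val_eqE /= eq_sym oner_neq0. Qed.

HB.instance Definition _ := isBiPointed.Build unitI unitI0_neq1.
End unit_interval.

Definition path_connected (R : realType) (X : topologicalType) (A : set X) :=
  forall x y, A x -> A y ->
    exists p : {path (unitI R) from x to y}, range p `<=` A.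

Definition locally_path_connected (R : realType) (X : topologicalType) :=
  forall (x : X) (U : set X), nbhs x U ->
    exists V : set X, [/\ open V, V x, V `<=` U & path_connected R V].

Notation contC R X := (continuousType X R[i]^o).
Notation contM R n := (continuousType (unitI R) 'M[R[i]^o]_n).

Section norms.
Variable R : realType.

Definition euclidean_norm n (v : 'cV[R[i]^o]_n) : R :=
  Num.sqrt (\sum_i Normc.normc (v i 0) ^+ 2).

(* The C*-norm on matrices, as opposed to the canonical mx_norm, which is the
   largest modulus of an entry. *)
Definition operator_norm n (A : 'M[R[i]^o]_n) : R :=
  sup [set euclidean_norm (A *m v) | v in [set v | euclidean_norm v <= 1]].

(* [sup] is 0 on the empty set, so this is also right when T is empty; it is
   only meaningful for bounded N \o f, as for continuous f on a compact T. *)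
Definition sup_norm (T A : Type) (N : A -> R) (f : T -> A) : R :=
  sup (range (N \o f)).

Definition contC_norm (X : topologicalType) (f : contC R X) : R :=
  sup_norm (@Normc.normc R) f.

Definition contM_norm n (f : contM R n) : R := sup_norm (@operator_norm n) f.
End norms.

Section homomorphisms.
Variables (R : realType) (X : topologicalType) (n : nat).

Definition starC (f : contC R X) : contC R X := (@conjo R[i]) \o f.

Definition starCM (f : contM R n) : contM R n :=
  (@adjmx R[i] n) \o f.

Definition unital_star_homM (h : contC R X -> 'M[R[i]^o]_n) :=
  [/\ linear h, monoid_morphism h & {morph h : f / starC f >-> adjmx f}].

Definition unital_star_homCM (h : contC R X -> contM R n) :=
  [/\ linear h, monoid_morphism h & {morph h : f / starC f >-> starCM f}].

Definition eval_at (t : unitI R) (f : contM R n) : 'M[R[i]^o]_n := f t.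
End homomorphisms.

(* Main.v *)
(* Pointwise in t, an ultraproduct-style limit shows that a unital, bounded, almost
   multiplicative map C(X) -> M_n is close to a genuine unital homomorphism, and
   every such homomorphism is f |-> U diag(f(x_1), ..., f(x_n)) U^* for a unitary U
   and points x_k of X. The space of pairs (U, x) is compact and, like X,
   locally path connected; hence two homomorphisms that are close on enough
   functions are joined by a short path of homomorphisms: in the limit both pairs
   represent the same homomorphism, through which the path can be chosen to pass.
   Approximating phi at the points of a fine grid of [0, 1], exactly so at the
   endpoints where phi is already a homomorphism, and joining neighbours by such
   paths yields psi. *)
Require Import Defs.
From mathcomp Require Import all_boot all_order all_algebra.
From mathcomp Require Import all_classical all_reals all_analysis.
From mathcomp Require Import homotopy complex ring lra.
Import Order.TTheory GRing.Theory Num.Theory.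
Import numFieldNormedType.Exports.
Local Open Scope classical_set_scope.
Local Open Scope ring_scope.

Set Implicit Arguments.
Unset Strict Implicit.
Unset Printing Implicit Defensive.

Import Normc.

(** * Moduli, entrywise closeness and operator norms *)

(** A homomorphism does not determine its pair (U, x): the points may be permuted and U may rotate
    inside a common eigenspace. Two homomorphisms that nearly agree on a finite set may thus have
    distant pairs, and a path between the given pairs need not be short; closeness only forces the
    limit pairs to represent one homomorphism. Hence the detour through that limit. The compactness
    arguments are non-effective: if no tolerance d and finite set G worked, there would be
    counterexamples for every (d, G), and an ultrafilter concentrating on arbitrarily small d and
    large G yields their limits. The resulting d and G do not depend on the map, so one choice
    serves all t in [0, 1] at once. The homomorphism picked at t need not vary continuously with t;
    continuity comes from phi alone, through its uniform continuity on finitely many functions.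
    Estimates are entrywise. Entries are bounded by the operator norm, so the hypotheses transfer
    for free; returning to norms in the conclusion costs a factor n^2. *)

Section modulus.
Variable R : realType.
Implicit Types z w : R[i].

(** The norm of [R[i]] takes its values in [R[i]], whereas the estimates below use the real-valued
    [normc]. *)
Lemma normrE z : `|z| = (real_complex R (normc z)). Proof. by []. Qed.

Lemma normc_ge0 z : 0 <= normc z.
Proof. by case: z => a b; exact: sqrtr_ge0. Qed.

Lemma normcB z w : normc (z - w) = normc (w - z).
Proof. by rewrite -normcN opprB. Qed.

Lemma normc_Re z : `|complex.Re z| <= normc z.
Proof. by rewrite -lecR; exact: normc_ge_Re. Qed.

Lemma normc_Im z : `|complex.Im z| <= normc z.
Proof.
by case: z => a b /=; rewrite -sqrtr_sqr ler_wsqrtr // lerDr sqr_ge0.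
Qed.

Lemma normc_le_ReIm z : normc z <= `|complex.Re z| + `|complex.Im z|.
Proof.
case: z => a b /=.
rewrite -[leRHS]ger0_norm ?addr_ge0// -sqrtr_sqr ler_wsqrtr // sqrrD.
by rewrite !real_normK ?num_real// addrAC lerDl mulrn_wge0// mulr_ge0.
Qed.

Lemma normc_sum (I : Type) (r : seq I) (P : pred I) (F : I -> R[i]) :
  normc (\sum_(i <- r | P i) F i) <= \sum_(i <- r | P i) normc (F i).
Proof.
elim/big_rec2: _ => [|i y x _ le_yx]; first by rewrite normc0.
by apply: le_trans (le_normcD _ _) _; rewrite lerD2l.
Qed.

Lemma normc_triangle z w t : normc (z - t) <= normc (z - w) + normc (w - t).
Proof. by rewrite (le_trans _ (le_normcD _ _))// addrA subrK. Qed.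

Lemma normc_real (a : R) : 0 <= a -> normc (real_complex R a) = a.
Proof. by move=> a0; rewrite /= expr0n addr0 sqrtr_sqr ger0_norm. Qed.

End modulus.

(** Stands in for the operator norm: it matches the entrywise topology of matrices, and composes by
    the triangle inequality without constants. *)
Definition mxclose (R : realType) m p (e : R) (A B : 'M[R[i]^o]_(m, p)) :=
  forall i j, normc (A i j - B i j) < e.

Section mxclose.
Variable R : realType.
Local Notation C := R[i].

Lemma cvg_normcP (T : Type) (F : set_system T) (FF : Filter F)
    (g : T -> C^o) (l : C^o) :
  g @ F --> l <-> forall e : R, 0 < e -> \forall t \near F, normc (g t - l) < e.
Proof.
split => [/cvg_ballP gl e e0|gl].
  have /gl : 0 < real_complex R e by rewrite ltcR.
  apply: filterS => t; rewrite /ball /= normrE ltcR.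
  by rewrite normcB.
apply/cvg_ballP => e e0.
(* Radii of balls live in [R[i]], but a positive element there is real. *)
have eE : e = real_complex R (complex.Re e) by rewrite RRe_real// gtr0_real.
have /gl : 0 < complex.Re e by move: e0; rewrite eE ltcR.
by apply: filterS => t; rewrite /ball /= eE normrE ltcR normcB.
Qed.

Lemma cvg_mxcloseP (T : Type) (F : set_system T) (FF : Filter F) m p
    (g : T -> 'M[C^o]_(m, p)) (L : 'M[C^o]_(m, p)) :
  g @ F --> L <-> forall e : R, 0 < e -> \forall t \near F, mxclose e (g t) L.
Proof.
split => [gL e e0|gL].
  move/cvg_ballP: gL => gL.
  have /gL : 0 < real_complex R e by rewrite ltcR.
  apply: filterS => t [_ gtL] i j; move: (gtL i j).
  by rewrite /ball /= normrE ltcR normcB.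
apply/cvg_ballP => e e0.
have eE : e = real_complex R (complex.Re e) by rewrite RRe_real// gtr0_real.
have /gL : 0 < complex.Re e by move: e0; rewrite eE ltcR.
apply: filterS => t gtL; split => // i j.
by rewrite /ball /= eE normrE ltcR normcB.
Qed.

Lemma cvg_mxP (T : Type) (F : set_system T) (FF : Filter F) m p
    (g : T -> 'M[C^o]_(m, p)) (L : 'M[C^o]_(m, p)) :
  g @ F --> L <-> forall i j, (fun t => g t i j : C^o) @ F --> (L i j : C^o).
Proof.
split => [/cvg_mxcloseP gL i j|gL].
  by apply/cvg_normcP => e /gL; apply: filterS => t; exact.
apply/cvg_mxcloseP => e e0.
apply: filter_forall => i; apply: filter_forall => j.
by move/cvg_normcP: (gL i j); apply.
Qed.

Lemma mxclose_sym m p e (A B : 'M[C^o]_(m, p)) : mxclose e A B -> mxclose e B A.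
Proof. by move=> AB i j; rewrite normcB. Qed.

Lemma mxclose_trans m p e e' (B A D : 'M[C^o]_(m, p)) :
  mxclose e A B -> mxclose e' B D -> mxclose (e + e') A D.
Proof.
move=> AB BD i j; apply: le_lt_trans (normc_triangle _ (B i j) _) _.
by rewrite ltrD.
Qed.

Lemma mxclosexx m p e (A : 'M[C^o]_(m, p)) : 0 < e -> mxclose e A A.
Proof. by move=> e0 i j; rewrite subrr normc0. Qed.

Lemma mxclose_le m p e e' (A B : 'M[C^o]_(m, p)) :
  e <= e' -> mxclose e A B -> mxclose e' A B.
Proof. by move=> ee' AB i j; apply: lt_le_trans ee'. Qed.

Lemma mxclose_eq m p (A B : 'M[C^o]_(m, p)) :
  (forall e, 0 < e -> mxclose e A B) -> A = B.
Proof.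
move=> AB; apply/matrixP => i j; apply/eqP; rewrite -subr_eq0; apply/eqP.
apply: eq0_normc; apply/eqP; rewrite eq_le normc_ge0 andbT.
by apply/ler_addgt0Pl => e e0; rewrite addr0 ltW// AB.
Qed.

Lemma mxclose_subP m p e (A B : 'M[C^o]_(m, p)) :
  mxclose e A B <-> mxclose e (A - B) 0.
Proof. by split => AB i j; move: (AB i j); rewrite !mxE subr0. Qed.

Lemma cvg_mx_unique (T : Type) (F : set_system T) (FF : ProperFilter F) m p
    (g : T -> 'M[C^o]_(m, p)) (A B : 'M[C^o]_(m, p)) :
  g @ F --> A -> g @ F --> B -> A = B.
Proof.
move=> /cvg_mxcloseP gA /cvg_mxcloseP gB; apply: mxclose_eq => e e0.
have e20 : 0 < e / 2 by rewrite divr_gt0.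
have [t [tA tB]] := filter_ex (filterI (gA _ e20) (gB _ e20)).
by rewrite [e]splitr; apply: mxclose_trans tB; exact: mxclose_sym.
Qed.

End mxclose.

Section operator_norm.
Variables (R : realType) (n : nat).
Local Notation C := R[i].
Implicit Types A B : 'M[C^o]_n.

Lemma euclidean_norm_ge_entry m (v : 'cV[C^o]_m) i :
  normc (v i 0) <= euclidean_norm v.
Proof.
rewrite -[leLHS]ger0_norm ?normc_ge0// -sqrtr_sqr ler_wsqrtr //.
by rewrite (bigD1 i)//= lerDl sumr_ge0// => j _; rewrite sqr_ge0.
Qed.

Lemma euclidean_norm_le_sum m (v : 'cV[C^o]_m) :
  euclidean_norm v <= \sum_i normc (v i 0).
Proof.
have s0 (s : seq 'I_m) : 0 <= \sum_(i <- s) normc (v i 0).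
  by apply: sumr_ge0 => i _; exact: normc_ge0.
rewrite -[leRHS]ger0_norm // -sqrtr_sqr ler_wsqrtr //.
elim: (index_enum _) => [|i s IH]; first by rewrite !big_nil expr0n.
rewrite !big_cons sqrrD addrAC; apply: le_trans (lerD (lexx _) IH) _.
by rewrite -addrA lerD2l lerDl mulrn_wge0// mulr_ge0 ?normc_ge0.
Qed.

Lemma euclidean_mul_le A (v : 'cV[C^o]_n) : euclidean_norm v <= 1 ->
  euclidean_norm (A *m v) <= \sum_i \sum_j normc (A i j).
Proof.
move=> v1; apply: le_trans (euclidean_norm_le_sum _) _.
apply: ler_sum => i _; rewrite mxE; apply: le_trans (normc_sum _ _ _) _.
apply: ler_sum => j _; rewrite normcM ler_piMr ?normc_ge0//.
exact: le_trans (euclidean_norm_ge_entry _ _) v1.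
Qed.

Let ops A := [set euclidean_norm (A *m v) | v in [set v | euclidean_norm v <= 1]].

Let ops_sup A : has_sup (ops A).
Proof.
split; last first.
  exists (\sum_i \sum_j normc (A i j)) => _ [v /= v1 <-].
  exact: euclidean_mul_le.
exists (euclidean_norm (A *m 0)), 0 => //=.
by rewrite /euclidean_norm big1 ?sqrtr0// => i _; rewrite mxE normc0 expr0n.
Qed.

Lemma operator_norm_le A : operator_norm A <= \sum_i \sum_j normc (A i j).
Proof.
apply: ge_sup; first by have [] := ops_sup A.
by move=> _ [v /= v1 <-]; exact: euclidean_mul_le.
Qed.

(** The j-th basis vector, of norm 1, is sent to column j, whose norm dominates each of its
    entries. *)
Lemma entry_le_operator_norm A i j : normc (A i j) <= operator_norm A.
Proof.
pose v : 'cV[C^o]_n := delta_mx j 0.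
have v1 : euclidean_norm v <= 1.
  rewrite /euclidean_norm (bigD1 j)//= big1 => [|k kj].
    by rewrite mxE !eqxx normc1 expr1n addr0 sqrtr1.
  by rewrite mxE (negPf kj) normc0 expr0n.
have -> : A i j = (A *m v) i 0 by rewrite -colE mxE.
apply: le_trans (euclidean_norm_ge_entry _ _) _.
by apply: ub_le_sup; [have [] := ops_sup A|exists v].
Qed.

End operator_norm.

(** * Ultrafilter limits *)

Section ultrafilter_limits.
Variable R : realType.
Local Notation C := R[i].

(** Shared engine of the compactness arguments: the sets [S d G] shrink as d decreases and G grows,
    so they form a filter base, and a finer ultrafilter meets every finite requirement
    simultaneously. *)
Lemma finitary_ultrafilter (I T : Type) (S : R -> set I -> set T) :
  (forall d d' G G', d <= d' -> G' `<=` G -> S d G `<=` S d' G') ->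
  (forall d G, 0 < d -> finite_set G -> S d G !=set0) ->
  exists U : set_system T,
    UltraFilter U /\ forall d G, 0 < d -> finite_set G -> U (S d G).
Proof.
move=> Smono S0.
pose D := [set dG : R * set I | 0 < dG.1 /\ finite_set dG.2].
pose B (dG : R * set I) := S dG.1 dG.2.
have BF : ProperFilter (filter_from D B).
  apply: filter_from_proper => [|[d G] [/= d0 Gf]]; last exact: S0.
  apply: filter_from_filter; first by exists (1, set0); split.
  move=> [d G] [d' G'] [/= d0 Gf] [/= d0' Gf'].
  exists (Num.min d d', G `|` G').
    by split=> /=; [rewrite lt_min d0|rewrite finite_setU].
  move=> t St; split; apply: Smono St => //=; rewrite ?ge_min ?lexx ?orbT//.
have [U [UU BU]] := ultraFilterLemma BF.
by exists U; split=> // d G d0 Gf; apply: BU; exists (d, G).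
Qed.

(** Compactness gives a cluster point of the image filter, and an ultrafilter converges to each of
    its cluster points. *)
Lemma ultra_compact_cvg (T : Type) (U : set_system T) (Y : topologicalType)
    (K : set Y) (g : T -> Y) : UltraFilter U ->
  compact K -> (\forall t \near U, K (g t)) -> exists2 y, K y & g @ U --> y.
Proof.
move=> UU cK gK.
have [|y [Ky clgy]] := cK (g @ U) _; first exact: gK.
exists y => // V yV; have [//|nV] := in_ultra_setVsetC (g @^-1` V) UU.
by have [z []] := clgy (~` V) V nV yV.
Qed.

Lemma ultra_bounded_cvg (T : Type) (U : set_system T) (g : T -> C^o) (c : R) :
  UltraFilter U -> (\forall t \near U, normc (g t) <= c) ->
  exists l : C^o, g @ U --> l.
Proof.
move=> UU gc.
have bnd (h : T -> R) : (\forall t \near U, `|h t| <= c) ->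
    exists l : R, h @ U --> l.
  move=> hc; have [|l _ hl] := ultra_compact_cvg UU (@segment_compact R (- c) c)
    (g := h); last by exists l.
  by apply: filterS hc => t; rewrite /= in_itv /= ler_norml.
have [|a ga] := bnd (fun t => complex.Re (g t)).
  by apply: filterS gc => t; exact: le_trans (normc_Re _).
have [|b gb] := bnd (fun t => complex.Im (g t)).
  by apply: filterS gc => t; exact: le_trans (normc_Im _).
exists (Complex a b); apply/cvg_normcP => e e0.
have e20 : 0 < e / 2 by rewrite divr_gt0.
move/cvgrPdist_lt: ga => /(_ _ e20) ga; move/cvgrPdist_lt: gb => /(_ _ e20) gb.
apply: filterS2 ga gb => t ta tb.
apply: le_lt_trans (normc_le_ReIm _) _; rewrite [ltRHS]splitr.
by case: (g t) ta tb => x y /= ta tb; rewrite ltrD// distrC.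
Qed.

Lemma ultra_bounded_mxcvg (T : Type) (U : set_system T) m p
    (g : T -> 'M[C^o]_(m, p)) (c : R) :
  UltraFilter U -> (\forall t \near U, forall i j, normc (g t i j) <= c) ->
  exists L : 'M[C^o]_(m, p), g @ U --> L.
Proof.
move=> UU gc.
have /= gl ij : exists l : C^o, (fun t => g t ij.1 ij.2 : C^o) @ U --> l.
  by apply: (@ultra_bounded_cvg _ _ _ c) => //; apply: filterS gc => t; exact.
have [l lP] := choice gl.
by exists (\matrix_(i, j) l (i, j)); apply/cvg_mxP => i j; rewrite mxE; exact: (lP (i, j)).
Qed.

End ultrafilter_limits.

(** * Sup norms, and the parameter interval [0, 1] as a retract of the line *)

Section norms.
Variable R : realType.
Local Notation C := R[i].

(** Compactness turns the local bounds |f y| + 1 into a global one. It is taken at least 1 so that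
    its inverse can serve as a scalar of modulus at most 1. *)
Lemma continuous_compact_normc_bounded (Y : topologicalType) (f : Y -> C^o) :
  compact [set: Y] -> continuous f ->
  exists2 c : R, 1 <= c & forall y, normc (f y) <= c.
Proof.
move=> cY fc; have /compact_near_coveringP nc := cY.
have : \forall c \near +oo%R, [set: Y] `<=` (fun y => normc (f y) <= c).
  apply: nc => y _.
  have /cvg_normcP /(_ 1 ltr01) fy := fc y.
  exists ([set z | normc (f z - f y) < 1], [set c | normc (f y) + 1 < c]).
    split => //=; exists (normc (f y) + 1); split=> //; exact: num_real.
  move=> [z c] [/= zy yc].
  rewrite -[f z](subrK (f y)) (le_trans (le_normcD _ _))// addrC ltW//.
  by apply: lt_trans yc; rewrite ltrD2l.
move=> [c [_ cP]]; exists (Num.max (c + 1) 1); first by rewrite le_max lexx orbT.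
move=> y; apply: cP => //; rewrite lt_max ltrDl ltr01 //.
Qed.

Lemma contC_norm_le1 (X : topologicalType) (f : contC R X) :
  (forall x, normc (f x) <= 1) -> contC_norm f <= 1.
Proof.
move=> f1; rewrite /contC_norm /sup_norm.
have [[x _]|X0] := pselect ([set: X] !=set0).
  apply: ge_sup; first by exists (normc (f x)), x.
  by move=> _ [z _ <-]; exact: f1.
(* For empty [X] the [sup] takes its default value 0. *)
by rewrite sup_out// => -[[_ [x _ _]] _]; apply: X0; exists x.
Qed.

(** Retraction of the line onto [0, 1]; through it, paths become functions of a real parameter that
    are constant outside [0, 1]. *)
Definition clampI (t : R) : R := Num.max 0 (Num.min t 1).

Lemma clampI_in t : clampI t \in (`[0, 1]%classic : set R).
Proof.
by rewrite inE /= in_itv /= /clampI le_max lexx /= ge_max ler01 ge_min lexx orbT.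
Qed.

Definition toI (t : R) : unitI R := SigSub (clampI_in t).

Lemma clampI_continuous : continuous clampI.
Proof.
move=> t.
have -> : clampI = (cst 0 : R -> R^o) \max ((idfun : R -> R^o) \min cst 1) by [].
apply: continuous_max; first exact: cvg_cst.
by apply: continuous_min; [exact: cvg_id|exact: cvg_cst].
Qed.

Lemma toI_continuous : continuous toI.
Proof. by apply: continuous_comp_initial => t; exact: clampI_continuous. Qed.

Lemma valI_continuous : continuous (val : unitI R -> R).
Proof. exact: initial_continuous. Qed.

Lemma toIK (t : unitI R) : toI (val t) = t.
Proof.
apply: val_inj; rewrite /= /clampI.
have : val t \in `[0, 1] by have := valP t; rewrite inE.
rewrite in_itv /= => /andP[t0 t1].
by rewrite (min_idPl t1) (max_idPr t0).
Qed.

Lemma toI0 t : t <= 0 -> toI t = unitI0 R.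
Proof.
move=> t0; apply: val_inj; rewrite /= /clampI.
by rewrite (min_idPl (le_trans t0 ler01)) (max_idPl t0).
Qed.

Lemma toI1 t : 1 <= t -> toI t = unitI1 R.
Proof.
move=> t1; apply: val_inj; rewrite /= /clampI.
by rewrite (min_idPr t1) (max_idPr ler01).
Qed.

Lemma unitI_compact : compact [set: unitI R].
Proof.
have -> : [set: unitI R] = toI @` `[0, 1]%classic.
  apply/seteqP; split=> // t _; exists (val t); last exact: toIK.
  by have := valP t; rewrite inE.
apply: continuous_compact; last exact: segment_compact.
exact/continuous_subspaceT/toI_continuous.
Qed.

Section contM_norm.
Variable n : nat.
Implicit Types f : contM R n.

Lemma contM_bounded f : exists c : R, forall t i j, normc (f t i j) <= c.
Proof.
have bij ij : exists c : R, forall t, normc (f t ij.1 ij.2) <= c.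
  have [|c _ fc] := continuous_compact_normc_bounded
    (f := fun t => f t ij.1 ij.2) unitI_compact; last by exists c.
  by move=> t; move/cvg_mxP: (@cts_fun _ _ f t); exact.
have [c cP] := choice bij.
exists (\sum_ij `|c ij|) => t i j; apply: le_trans (cP (i, j) t) _.
rewrite (bigD1 (i, j))//= (le_trans (ler_norm _))// lerDl.
by rewrite sumr_ge0.
Qed.

(** The source of the factor n^2 that the final choice of [e1] absorbs. *)
Lemma operator_norm_le_entries (A : 'M[C^o]_n) (c : R) :
  (forall i j, normc (A i j) <= c) -> operator_norm A <= n%:R * (n%:R * c).
Proof.
move=> Ac; apply: le_trans (operator_norm_le _) _.
have -> : n%:R * (n%:R * c) = \sum_(i < n) \sum_(j < n) c.
  by rewrite !sumr_const card_ord !mulr_natl.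
by apply: ler_sum => i _; apply: ler_sum => j _.
Qed.

Lemma contM_norm_lt f (d : R) :
  contM_norm f < d -> forall t i j, normc (f t i j) < d.
Proof.
move=> fd t i j; apply: le_lt_trans (entry_le_operator_norm _ _ _) _.
apply: le_lt_trans fd; apply: ub_le_sup; last by exists t.
have [c fc] := contM_bounded f.
exists (n%:R * (n%:R * c)) => _ [s _ <-].
exact: operator_norm_le_entries.
Qed.

Lemma contM_norm_mxclose f (d : R) :
  contM_norm f < d -> forall t, mxclose d (f t) 0.
Proof. by move=> fd t i j; rewrite [X in _ - X]mxE subr0; exact: contM_norm_lt. Qed.

Lemma contM_norm_le f (d : R) :
  contM_norm f <= d -> forall t i j, normc (f t i j) <= d.
Proof.
move=> fd t i j; apply/ler_addgt0Pl => e e0; rewrite addrC.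
by apply/ltW/contM_norm_lt; rewrite (le_lt_trans fd)// ltrDl.
Qed.

Lemma le_contM_norm f (c : R) :
  (forall t i j, normc (f t i j) <= c) -> contM_norm f <= n%:R * (n%:R * c).
Proof.
move=> fc; apply: ge_sup; first by exists (operator_norm (f zero)), zero.
by move=> _ [t _ <-]; exact: operator_norm_le_entries.
Qed.

End contM_norm.
End norms.

(** * Diagonal homomorphisms *)

Lemma conj_mulr (S : pzRingType) (u v a b : S) :
  v * u = 1 -> u * (a * b) * v = (u * a * v) * (u * b * v).
Proof.
by move=> vu; rewrite !mulrA -(mulrA (u * a) v u) vu mulr1.
Qed.

Section diagonal_homomorphisms.
Variables (R : realType) (n : nat).
Local Notation C := R[i].
Local Notation Mn := 'M[C^o]_n.

Lemma adjmxM (A B : Mn) : adjmx (A * B) = adjmx B * adjmx A.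
Proof.
rewrite /adjmx; apply/matrixP => i j; rewrite !mxE rmorph_sum.
by apply: eq_bigr => k _; rewrite !mxE rmorphM mulrC.
Qed.

Lemma adjmxK : involutive (@adjmx C n).
Proof. by move=> A; apply/matrixP => i j; rewrite !mxE conjCK. Qed.

(* For n = 0 the ring 'M_n is trivial, hence not an algebra in the library. *)
Lemma mx_scalerAl (a : C) (A B : Mn) : (a *: A) * B = a *: (A * B).
Proof. exact/esym/scalemxAl. Qed.

Lemma mx_scalerAr (a : C) (A B : Mn) : A * (a *: B) = a *: (A * B).
Proof. exact/esym/scalemxAr. Qed.

Lemma cvg_mxmul (T : Type) (F : set_system T) (FF : Filter F)
    (f g : T -> Mn) (A B : Mn) :
  f @ F --> A -> g @ F --> B -> (fun t => f t * g t) @ F --> A * B.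
Proof.
move=> fA gB.
apply: (@cvg_comp _ _ _ (fun t => (f t, g t)) (fun z : Mn * Mn => z.1 * z.2)).
  exact: cvg_pair fA gB.
exact: (@mxring_mul_continuous C n (A, B)).
Qed.

Lemma cvg_mxZ (T : Type) (F : set_system T) (FF : Filter F)
    (f : T -> Mn) (a : C) (A : Mn) :
  f @ F --> A -> (fun t => a *: f t : Mn) @ F --> (a *: A : Mn).
Proof.
move=> fA; rewrite -mul_scalar_mx; under eq_fun do rewrite -mul_scalar_mx.
apply: (@cvg_mxmul _ _ _ (cst (a%:M : Mn))); [exact: cvg_cst|exact: fA].
Qed.

Lemma cvg_mxD (T : Type) (F : set_system T) (FF : Filter F)
    (f g : T -> Mn) (A B : Mn) :
  f @ F --> A -> g @ F --> B -> (fun t => f t + g t) @ F --> A + B.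
Proof.
move=> /cvg_mxcloseP fA /cvg_mxcloseP gB; apply/cvg_mxcloseP => e e0.
have e20 : 0 < e / 2 by rewrite divr_gt0.
apply: filterS2 (fA _ e20) (gB _ e20) => t ft gt i j; rewrite !mxE [e]splitr.
by rewrite opprD addrACA; apply: le_lt_trans (le_normcD _ _) _; rewrite ltrD.
Qed.

Lemma cvg_adjmx (T : Type) (F : set_system T) (FF : Filter F)
    (f : T -> Mn) (A : Mn) :
  f @ F --> A -> (fun t => adjmx (f t)) @ F --> adjmx A.
Proof. move=> fA; apply: (@cvg_comp _ _ _ f (@adjmx C n)); first exact: fA.
exact: (@adjmx_continuous C n A). Qed.

Definition unitary (U : Mn) := U * adjmx U = 1.

Lemma unitary_adjK (U : Mn) : unitary U -> adjmx U * U = 1.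
Proof. exact: mulmx1C. Qed.

Lemma unitary_adj (U : Mn) : unitary U -> unitary (adjmx U).
Proof. by rewrite {2}/unitary adjmxK => /unitary_adjK. Qed.

Lemma unitaryM (U V : Mn) : unitary U -> unitary V -> unitary (U * V).
Proof.
by move=> uU uV; rewrite /unitary adjmxM mulrA -(mulrA U) uV mulr1; exact: uU.
Qed.

(** Each row of a unitary has Euclidean norm 1. This boundedness is what gives limits of unitaries
    along ultrafilters. *)
Lemma unitary_entry_le1 (U : Mn) i j : unitary U -> normc (U i j) <= 1.
Proof.
move=> /matrixP /(_ i i); rewrite !mxE eqxx => uU.
have : \sum_k normc (U i k) ^+ 2 = 1.
  apply: complexI; rewrite rmorph_sum rmorph1 -[RHS]uU.
  apply: eq_bigr => k _; rewrite !mxE rmorphXn /= -normrE.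
  by rewrite -normCK.
rewrite (bigD1 j)//= => U1.
rewrite -(@ler_pXn2r _ 2) ?nnegrE ?normc_ge0 ?ler01 // expr1n -U1.
by rewrite lerDl sumr_ge0// => k _; rewrite sqr_ge0.
Qed.

Section points.
Variable X : topologicalType.

(* Every unital homomorphism C(X) -> M_n is of this form: the joint spectrum is
   a list of n points, and U diagonalizes the image. *)
Definition diag_hom (U : Mn) (x : 'I_n -> X) (f : contC R X) : Mn :=
  U * diag_mx (\row_k (f (x k) : C^o)) * adjmx U.

Lemma diag_hom_unital_star_hom U x : unitary U -> unital_star_homM (diag_hom U x).
Proof.
move=> uU; rewrite /diag_hom; split.
- move=> a f g.
  have -> : \row_k ((a *: f + g) (x k)) =
      a *: (\row_k (f (x k) : C^o)) + \row_k (g (x k) : C^o) :> 'rV[C^o]_n.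
    by apply/rowP => k; rewrite !mxE.
  by rewrite linearP /= mulrDr mulrDl mx_scalerAr mx_scalerAl.
- split.
    have -> : \row_k ((1 : contC R X) (x k) : C^o) = const_mx 1 :> 'rV[C^o]_n.
      by apply/rowP => k; rewrite !mxE.
    by rewrite diag_const_mx mulr1.
  move=> f g; rewrite -(conj_mulr _ _ (unitary_adjK uU)).
  have -> // : diag_mx (\row_k ((f * g) (x k) : C^o)) =
    diag_mx (\row_k (f (x k) : C^o)) * diag_mx (\row_k (g (x k) : C^o)) :> Mn.
  rewrite [RHS]mulmx_diag; congr diag_mx.
  by apply/rowP => k; rewrite !mxE.
- move=> f; rewrite !adjmxM adjmxK.
  have -> : adjmx (diag_mx (\row_k (f (x k) : C^o))) =
      diag_mx (\row_k (starC f (x k) : C^o)) :> Mn; last exact/esym/mulrA.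
  apply/matrixP => i j; rewrite !mxE rmorphMn /= /starC /conjo eq_sym.
  by case: eqVneq => [->//|_]; rewrite !mulr0n.
Qed.

(** Joint continuity in the pair; convergence of the points is asked coordinatewise, so that no
    topology on ['I_n -> X] has to be fixed. *)
Lemma cvg_diag_hom (T : Type) (F : set_system T) (FF : Filter F)
    (u : T -> Mn) (x : T -> 'I_n -> X) (u0 : Mn) (x0 : 'I_n -> X) (f : contC R X) :
  u @ F --> u0 -> (forall k, (fun t => x t k) @ F --> x0 k) ->
  (fun t => diag_hom (u t) (x t) f) @ F --> diag_hom u0 x0 f.
Proof.
move=> uF xF; rewrite /diag_hom; apply: cvg_mxmul; last exact: cvg_adjmx.
apply: cvg_mxmul; first exact: uF.
apply/cvg_mxP => i j; rewrite !mxE.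
under eq_fun do rewrite !mxE.
case: eqVneq => [->|_]; last by apply: cvg_cst.
by rewrite mulr1n; under eq_fun do rewrite mulr1n; apply: cvg_comp (xF _) _; exact: cts_fun.
Qed.

(** Compactness of the space of pairs, in ultrafilter form; the relation U U^* = 1 passes to the
    limit by continuity. *)
Lemma ultra_diag_cvg (T : Type) (F : set_system T) (u : T -> Mn)
    (x : T -> 'I_n -> X) : UltraFilter F -> compact [set: X] ->
    (\forall t \near F, unitary (u t)) ->
  exists (u0 : Mn) (x0 : 'I_n -> X), [/\ unitary u0,
    u @ F --> u0 & forall k, (fun t => x t k) @ F --> x0 k].
Proof.
move=> UF cX uF.
have [|u0 u0P] := @ultra_bounded_mxcvg _ _ F _ _ u 1 UF.
  by apply: filterS uF => t ut i j; exact: unitary_entry_le1.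
have xk k : exists y : X, (fun t => x t k) @ F --> y.
  by have [|y _ ?] := ultra_compact_cvg (g := x^~ k) UF cX; [exact: filterE|exists y].
have [x0 x0P] := choice xk.
exists u0, x0; split=> //.
apply: (@cvg_mx_unique _ _ F _ _ _ (fun t => u t * adjmx (u t))).
  by apply: cvg_mxmul; [exact: u0P|exact: cvg_adjmx].
by apply/cvg_mxcloseP => e e0; apply: filterS uF => t ->; exact: mxclosexx.
Qed.

End points.
End diagonal_homomorphisms.

(** * Homomorphisms into M_n are diagonal *)

Section spectral_theorem.
Variables (R : realType) (n : nat).
Local Notation C := R[i].
Local Notation Mn := 'M[C^o]_n.

(** Commuting matrices are triangularized by one unitary. An entry on the other side of the diagonal
    is the conjugate of an entry of the adjoint, which is triangular as well, so all matrices become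
    diagonal. *)
Lemma commuting_star_family_diag (s : seq Mn) :
  {in s &, forall A B, A * B = B * A} -> {in s, forall A, adjmx A \in s} ->
  exists2 P : Mn, unitary P &
    forall A, A \in s -> forall i j, i != j -> (P * A * adjmx P) i j = 0.
Proof.
move=> scomm sadj.
have [P /unitarymxP PU /allP Ptrig] := @cotrigonalization C n s scomm.
have adjE (A : Mn) : adjmx A = (map_mx Num.conj A^T)%R.
  by apply/matrixP => i j; rewrite !mxE.
have uP : unitary P by rewrite /unitary adjE; exact: PU.
have trig A (i j : 'I_n) : A \in s -> (i < j)%N -> (P * A * adjmx P) i j = 0.
  move=> As ij; have := Ptrig A As.
  rewrite inE /= /similar_to conjymx; last exact/unitarymxP.
  by move/is_trig_mxP => /(_ i j ij); rewrite adjE; exact.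
exists P => // A As i j; rewrite neq_ltn => /orP[|ji]; first exact: trig.
have := trig _ j i (sadj _ As) ji.
have -> : P * adjmx A * adjmx P = adjmx (P * A * adjmx P).
  by rewrite !adjmxM adjmxK; exact/esym/mulrA.
by rewrite !mxE => /(congr1 (Num.conj)); rewrite conjCK rmorph0.
Qed.

Lemma continuous_inv (X : topologicalType) (g : X -> C^o) :
  continuous g -> (forall x, g x != 0) -> continuous (fun x => (g x)^-1 : C^o).
Proof.
move=> gc g0 x; apply/cvg_normcP => e e0.
have gx0 : 0 < normc (g x).
  by rewrite lt_neqAle normc_ge0 andbT eq_sym; apply: contra_neq (g0 x); exact: eq0_normc.
(* The first bound keeps |g y| above |g x| / 2; the second then makes |g x - g y| / (|g y| |g x|)
   less than e. *)
pose d := Num.min (normc (g x) / 2) (e * (normc (g x) / 2 * normc (g x))).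
have d0 : 0 < d by rewrite lt_min divr_gt0// !mulr_gt0.
have /cvg_normcP /(_ d d0) := gc x.
apply: filterS => y; rewrite lt_min => /andP[yd ye].
have gy : normc (g x) / 2 < normc (g y).
  have := normc_triangle (g x) (g y) 0; rewrite !subr0 normcB => le.
  by rewrite -(ltrD2r (normc (g x) / 2)) -splitr (le_lt_trans le)// addrC ltrD2l.
have gy0 : 0 < normc (g y) by apply: lt_trans gy; rewrite divr_gt0.
have -> : (g y)^-1 - (g x)^-1 = (g x - g y) * ((g y)^-1 * (g x)^-1).
  rewrite mulrBl mulrCA mulfV ?g0// mulr1 mulrA mulfV ?g0 //.
  by rewrite mul1r.
rewrite !normcM !normcV normcB -invfM ltr_pdivrMr ?mulr_gt0//.
by apply: lt_le_trans ye _; rewrite ler_pM2l// ler_pM2r// ltW.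
Qed.

Variable X : topologicalType.
Implicit Types (h : contC R X -> Mn) (f : contC R X).

(** The images commute and can be diagonalized together; the point is that the k-th diagonal entries
    [chi k f] are the values f(x) at a common x. This is done for finite lists, to which
    simultaneous triangularization applies. *)
Lemma finite_joint_spectrum h (s : seq (contC R X)) : unital_star_homM h ->
  exists U x, unitary U /\ forall f, f \in s -> h f = diag_hom U x f.
Proof.
move=> [hlin [h1 hM] hstar].
(* Closed under adjoints, as the diagonalization requires. *)
pose s' := s ++ map (@starC R X) s.
have starK : involutive (@starC R X).
  by move=> f; apply/continuousEP => x; exact: conjCK.
have [||P uP Pdiag] := @commuting_star_family_diag (map h s').
- move=> _ _ /mapP[f _ ->] /mapP[g _ ->]; rewrite -!hM; congr h.
  by apply/continuousEP => x; exact: mulrC.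
- move=> _ /mapP[f fs ->]; rewrite -hstar; apply: map_f.
  move: fs; rewrite !mem_cat => /orP[fs|/mapP[g gs ->]].
    by rewrite map_f ?orbT.
  by rewrite starK gs.
pose T A : Mn := P * A * adjmx P.
have TM A B : T (A * B) = T A * T B by exact/conj_mulr/unitary_adjK.
have TD A B : T (A + B) = T A + T B by rewrite /T mulrDr mulrDl.
have hD f g : h (f + g) = h f + h g by rewrite -[f]scale1r hlin !scale1r.
have h0 : h 0 = 0 by apply: (@addrI _ (h 0)); rewrite -hD !addr0.
have T0 : T 0 = 0 by rewrite /T mulr0 mul0r.
have T1 : T 1 = 1 by rewrite /T mulr1.
pose chi k f : C := T (h f) k k.
have chiP k : exists x, forall f, f \in s -> f x = chi k f.
  pose fk f : contC R X := f - chi k f *: (1 : contC R X).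
  (* This is the sum of the |f - chi k f|^2: its zeros are exactly the common solutions x, and if
     there is none it is invertible in C(X). *)
  pose g : contC R X := \sum_(f <- s) fk f * starC (fk f).
  have fkE f x : fk f x = f x - chi k f by rewrite -[X in _ - X]mulr1.
  have gE x : g x = \sum_(f <- s) `|f x - chi k f| ^+ 2.
    rewrite /g; elim: (s) => [|f r IH]; first by rewrite !big_nil.
    rewrite !big_cons -IH; congr (_ + _).
    by rewrite normCK -fkE.
  have [[x gx0]|gN0] := pselect (exists x, g x = 0).
    exists x => f fs; apply/eqP; rewrite -subr_eq0 -normr_eq0 -sqrf_eq0.
    move: gx0; rewrite gE => /eqP; rewrite big_seq psumr_eq0; last first.
      by move=> f' _; rewrite exprn_ge0.
    by move/allP => /(_ f fs); rewrite fs.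
  (* Row k of P h(f - chi f) P^* vanishes for f in s, hence so does row k of
     P h(g) P^*; but g is invertible. *)
  exfalso.
  have gi0 x : g x != 0 by apply/eqP => gx0; apply: gN0; exists x.
  pose gi : contC R X := mkcts (continuous_inv (@cts_fun _ _ g) gi0).
  have ggi : g * gi = 1 by apply/continuousEP => x; exact: mulfV.
  have rowfk f : f \in s -> forall j, T (h (fk f)) k j = 0.
    move=> fs j.
    have -> : h (fk f) = - chi k f *: (1 : Mn) + h f.
      have -> : fk f = - chi k f *: (1 : contC R X) + f by rewrite scaleNr addrC.
      by rewrite hlin h1.
    have -> : T (- chi k f *: (1 : Mn) + h f) = - chi k f *: (1 : Mn) + T (h f).
      by rewrite TD /T mx_scalerAr mulr1 mx_scalerAl uP.
    rewrite mxE [X in X + _]mxE [X in _ * X + _]mxE.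
    case: eqVneq => [<-|kj]; first by rewrite mulr1 addNr.
    rewrite mulr0 add0r; apply: Pdiag => //.
    by rewrite map_f// mem_cat fs.
  have rowg j : T (h g) k j = 0.
    rewrite /g big_seq; elim/big_rec: _ => [|f r fs IH]; first by rewrite h0 T0 mxE.
    rewrite hD TD mxE IH addr0 hM TM [LHS]mxE big1// => l _.
    by rewrite rowfk// mul0r.
  have := congr1 (fun A => T (h A) k k) ggi.
  rewrite hM TM h1 T1 [in RHS]mxE eqxx [LHS]mxE big1 => [/esym/eqP|l _].
    by rewrite oner_eq0.
  by rewrite rowg mul0r.
have [x xP] := choice chiP.
exists (adjmx P), x; split; first exact: unitary_adj.
move=> f fs; rewrite /diag_hom adjmxK.
have -> : diag_mx (\row_k (f (x k) : C^o)) = T (h f).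
  apply/matrixP => i j; rewrite !mxE; case: eqVneq => [<-|ij].
    by rewrite mulr1n xP// /chi /T !mxE.
  rewrite mulr0n; apply/esym; have := Pdiag (h f) _ i j ij; rewrite /T !mxE; apply.
  by rewrite map_f// mem_cat fs.
rewrite /T; set A := h f; have PP := unitary_adjK uP.
have assoc (S : pzRingType) (p q a : S) : q * p = 1 -> q * (p * a * q) * p = a.
  by move=> qp; rewrite -!mulrA qp mulr1 mulrA qp mul1r.
by rewrite assoc.
Qed.

(** Passes from finite lists to all of C(X): a limit of pairs representing h on ever larger finite
    sets represents h everywhere, since for each f the value [diag_hom p.1 p.2 f] is eventually h
    f. *)
Theorem unital_star_hom_diag h : compact [set: X] -> unital_star_homM h ->
  exists U x, unitary U /\ h = diag_hom U x.
Proof.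
move=> cX hh.
pose S (_ : R) (G : set (contC R X)) : set (Mn * ('I_n -> X)) :=
  [set p | unitary p.1 /\ forall f, G f -> h f = diag_hom p.1 p.2 f].
have [d d' G G' _ GG' p [pu pG]|d G _ Gfin|F [UF FS]] :=
  @finitary_ultrafilter R _ _ S.
- by split=> // f /GG'; exact: pG.
- have /finite_seqP[s sG] := Gfin.
  have [U [x [uU hU]]] := finite_joint_spectrum s hh.
  by exists (U, x); split=> // f; rewrite sG; exact: hU.
have [|U [x [uU FU Fx]]] := @ultra_diag_cvg R n X _ F fst snd UF cX.
  by apply: filterS (FS 1 set0 ltr01 (finite_set0 _)) => p [].
exists U, x; split=> //; apply/funext => f.
apply: (@cvg_mx_unique R _ F _ n n (fun p => diag_hom p.1 p.2 f)); last first.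
  exact: (@cvg_diag_hom R n X _ F _ fst snd).
apply/cvg_mxcloseP => e e0.
apply: filterS (FS 1 [set f] ltr01 (finite_set1 _)) => p [_ pf].
by rewrite -pf//; exact: mxclosexx.
Qed.

End spectral_theorem.

(** * Almost multiplicative maps are close to homomorphisms *)

Lemma near_finite_set (T I : Type) (F : set_system T) (A : set I) (P : I -> T -> Prop) :
  Filter F -> finite_set A -> (forall i, A i -> \forall t \near F, P i t) ->
  \forall t \near F, forall i, A i -> P i t.
Proof.
move=> FF; elim/Pchoice: I => I in A P *.
move=> /finite_seqP[s ->{A}]; elim: s => [|i s IH] AP.
  by apply: nearW => t i; rewrite /= in_nil.
have Pi : \forall t \near F, P i t by apply: AP; rewrite /= mem_head.
have Ps : \forall t \near F, forall j, [set` s] j -> P j t.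
  by apply: IH => j js; apply: AP; rewrite /= in_cons js orbT.
apply: filterS2 Pi Ps => t Pit Pst j /=.
by rewrite in_cons => /predU1P[->//|]; exact: Pst.
Qed.

Section near_homomorphisms.
Variables (R : realType) (n : nat) (X : topologicalType).
Local Notation C := R[i].
Local Notation Mn := 'M[C^o]_n.
Implicit Types (phi h : contC R X -> Mn) (f : contC R X).

(** The relations that the theorem imposes on phi, read entrywise at a single t. *)
Definition near_multiplicative (d : R) (G : set (contC R X)) phi :=
  forall (a b : C) x y, normc a <= 1 -> normc b <= 1 -> G x -> G y ->
    [/\ mxclose d (phi (a *: x + b *: y)) (a *: phi x + b *: phi y),
        mxclose d (phi (x * y)) (phi x * phi y) &
        mxclose d (phi (starC x)) (adjmx (phi x))].

Definition contractive_bound (M : R) phi :=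
  forall f, contC_norm f <= 1 -> forall i j, normc (phi f i j) <= M.

(** As [phi] is not linear, its bound on the unit ball does not scale by itself. Near-linearity with
    scalars 1/c and 0 compares phi(f)/c with phi(f/c) at the cost of 1. *)
Lemma entries_bounded (M c : R) f phi : 1 <= c -> (forall x, normc (f x) <= c) ->
  contractive_bound M phi -> near_multiplicative 1 [set f] phi ->
  forall i j, normc (phi f i j) <= c * (1 + M).
Proof.
move=> c1 fc Mphi nphi i j.
have c0 : 0 < c by apply: lt_le_trans c1.
pose a : C := real_complex R c^-1.
have na : normc a = c^-1 by rewrite normc_real ?invr_ge0 ?ltW.
have a1 : normc a <= 1 by rewrite na invf_le1.
have nrm0 : normc (0 : C) <= 1 by rewrite normc0.
have [/(_ i j) + _ _] := nphi a 0 f f a1 nrm0 erefl erefl.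
rewrite !scale0r !addr0 mxE => close.
have /Mphi /(_ i j) Ma : contC_norm (a *: f) <= 1.
  apply: contC_norm_le1 => x; rewrite [_ x]/(a * f x) normcM na.
  by rewrite ler_pdivrMl// mulr1.
have := normc_triangle (a * phi f i j) (phi (a *: f) i j) 0.
rewrite !subr0 normcM na normcB => le.
rewrite -ler_pdivrMl//; apply: le_trans le _; rewrite lerD//; exact: ltW.
Qed.

(** Each algebraic relation involves finitely many functions, and holds along [U] up to any positive
    error, hence exactly in the limit. *)
Lemma ultra_limit_unital_star_hom (U : set_system (contC R X -> Mn)) h :
  ProperFilter U -> (forall d G, 0 < d -> finite_set G ->
    \forall phi \near U, phi 1 = 1 /\ near_multiplicative d G phi) ->
  (forall f, (fun phi => phi f) @ U --> h f) -> unital_star_homM h.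
Proof.
move=> UU Unear Uh.
have h1 : h 1 = 1.
  apply: (@cvg_mx_unique R _ U _ n n (fun phi => phi 1)); first exact: Uh.
  apply/cvg_mxcloseP => e e0.
  apply: filterS (Unear 1 set0 ltr01 (finite_set0 _)) => phi [-> _].
  exact: mxclosexx.
have Ulim (u v : (contC R X -> Mn) -> Mn) (A B : Mn) (G : set (contC R X)) :
    finite_set G -> u @ U --> A -> v @ U --> B ->
    (forall d phi, near_multiplicative d G phi -> mxclose d (u phi) (v phi)) -> A = B.
  move=> Gf uA vB uv; apply: mxclose_eq => e e0.
  have e30 : 0 < e / 3 by rewrite divr_gt0.
  move/cvg_mxcloseP: uA => /(_ _ e30) uA; move/cvg_mxcloseP: vB => /(_ _ e30) vB.
  have [phi [[pA pB] [_ /uv puv]]] :=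
    filter_ex (filterI (filterI uA vB) (Unear _ G e30 Gf)).
  have -> : e = e / 3 + e / 3 + e / 3 by lra.
  apply: mxclose_trans pB; apply: mxclose_trans puv; exact: mxclose_sym.
have hlin a b x y : normc a <= 1 -> normc b <= 1 ->
    h (a *: x + b *: y) = a *: h x + b *: h y.
  move=> a1 b1.
  apply: (Ulim (fun phi => phi (a *: x + b *: y))
               (fun phi => a *: phi x + b *: phi y) _ _ [set x; y]).
  - by rewrite finite_setU; split.
  - exact: Uh.
  - by apply: cvg_mxD; apply: cvg_mxZ; exact: Uh.
  - move=> d phi /(_ a b x y a1 b1) [||//]; [by left|by right].
have n1 : normc (1 : C) <= 1 by rewrite normc1.
have n0 : normc (0 : C) <= 1 by rewrite normc0.
have hZ a x : h (a *: x) = a *: h x.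
  have hZ1 b z : normc b <= 1 -> h (b *: z) = b *: h z.
    by move=> b1; have := hlin b 0 z z b1 n0; rewrite !scale0r !addr0.
  have [a1|a1] := leP (normc a) 1; first exact: hZ1.
  (* Near-linearity only covers scalars of modulus at most 1; a larger a is handled by applying that
     case to its inverse and the function a x. *)
  have a0 : a != 0 by apply: contraTneq a1 => ->; rewrite normc0 -leNgt ler01.
  rewrite -[in RHS](scale1r x) -(mulVf a0) -scalerA (hZ1 a^-1).
    by rewrite scalerA mulfV// scale1r.
  by rewrite normcV invf_le1 ?ltW// (lt_trans _ a1).
split.
- by move=> a x y; have := hlin 1 1 (a *: x) y n1 n1; rewrite !scale1r hZ.
- split=> // x y.
  apply: (Ulim (fun phi => phi (x * y)) (fun phi => phi x * phi y) _ _ [set x; y]).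
  + by rewrite finite_setU; split.
  + exact: Uh.
  + by apply: cvg_mxmul; exact: Uh.
  + by move=> d phi /(_ 1 1 x y n1 n1) [||//]; [by left|by right].
- move=> x; apply: (Ulim (fun phi => phi (starC x)) (fun phi => adjmx (phi x)) _ _ [set x]).
  + exact: finite_set1.
  + exact: Uh.
  + by apply: cvg_adjmx; exact: Uh.
  + by move=> d phi /(_ 1 1 x x n1 n1) [].
Qed.

(** Counterexamples for all (d, G) would have a pointwise limit along an ultrafilter, and that limit
    is a homomorphism. As F is finite, pointwise convergence brings some counterexample within e of
    it on all of F. *)
Lemma near_multiplicative_near_hom (M e : R) (F : set (contC R X)) :
  compact [set: X] -> 0 < e -> finite_set F ->
  exists d G, [/\ 0 < d, finite_set G & forall phi, phi 1 = 1 ->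
    contractive_bound M phi -> near_multiplicative d G phi ->
    exists2 h, unital_star_homM h & forall f, F f -> mxclose e (phi f) (h f)].
Proof.
move=> cX e0 Ff; apply: contrapT => no.
pose good phi := exists2 h, unital_star_homM h & forall f, F f -> mxclose e (phi f) (h f).
pose S d G := [set phi | [/\ phi 1 = 1, contractive_bound M phi,
  near_multiplicative d G phi & ~ good phi]].
have [d d' G G' dd' GG' phi [p1 pM pm pg]|d G d0 Gfin|U [UU US]] :=
  @finitary_ultrafilter R _ _ S.
- split=> // a b x y a1 b1 /GG' Gx /GG' Gy; have [? ? ?] := pm a b x y a1 b1 Gx Gy.
  by split; exact: mxclose_le dd' _.
- apply: contrapT => S0; apply: no; exists d, G; split=> // phi p1 pM pm.
  by apply: contrapT => pg; apply: S0; exists phi.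
have lim f : exists L : Mn, (fun phi : contC R X -> Mn => phi f) @ U --> L.
  have [c c1 fc] := continuous_compact_normc_bounded cX (@cts_fun _ _ f).
  apply: (ultra_bounded_mxcvg (c := c * (1 + M))).
  apply: filterS (US 1 [set f] ltr01 (finite_set1 _)) => phi [_ pM pm _].
  exact: entries_bounded.
have [h hP] := choice lim.
have hh : unital_star_homM h.
  apply: (ultra_limit_unital_star_hom (U := U)) => // d G d0 Gf.
  by apply: filterS (US d G d0 Gf) => phi [].
have near_h : \forall phi \near U, forall f, F f -> mxclose e (phi f) (h f).
  apply: near_finite_set => // f _.
  by have /cvg_mxcloseP := hP f; exact.
have [phi [[_ _ _ pg] ph]] := filter_ex (filterI (US 1 set0 ltr01 (finite_set0 _)) near_h).
by apply: pg; exists h.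
Qed.

End near_homomorphisms.

(** * Short paths of unitaries *)

Section unitary_paths.
Variables (R : realType) (n : nat).
Local Notation C := R[i].
Local Notation Mn := 'M[C^o]_n.

Lemma clampI_ge0_le1 (t : R) : 0 <= clampI t <= 1.
Proof. by have := clampI_in t; rewrite inE /= in_itv. Qed.

(** The segment from z to 1 stays away from 0, so it can be normalized. Normalizing moves a point v
    by |1 - |v||, at most |v - 1|, whence the factor 2. *)
Lemma circle_path (z : C) : normc z = 1 -> normc (z - 1) <= 1 / 2 ->
  exists w : R -> C^o, [/\ continuous w, forall t, normc (w t) = 1,
    forall t, t <= 0 -> w t = z, forall t, 1 <= t -> w t = 1 &
    forall t, normc (w t - 1) <= 2 * normc (z - 1)].
Proof.
move=> z1 zB.
pose rc : R -> C^o := real_complex R.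
have rcB a b : normc (rc a - rc b) = `|a - b|.
  by rewrite -rmorphB /= expr0n addr0 sqrtr_sqr.
pose v t : C^o := 1 + rc (1 - clampI t) * (z - 1).
have vB t : normc (v t - 1) <= normc (z - 1).
  have /andP[s0 s1] := clampI_ge0_le1 t.
  rewrite /v addrAC subrr add0r normcM normc_real ?subr_ge0//.
  by rewrite ler_piMl ?normc_ge0// gerBl.
have v0 t : 0 < normc (v t).
  have := normc_triangle 1 (v t) 0; rewrite !subr0 normc1 normcB => le.
  have := vB t; lra.
have nv0 t : rc (normc (v t)) != 0.
  by apply/eqP => /complexI vt; have := v0 t; rewrite vt ltxx.
have vc : continuous v.
  move=> t; apply/cvg_normcP => e e0.
  move/cvgrPdist_lt: (@clampI_continuous R t) => /(_ _ e0); apply: filterS => s st.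
  rewrite /v opprD addrACA subrr add0r -mulrBl normcM rcB.
  apply: le_lt_trans (_ : `|clampI t - clampI s| * 1 < e); last by rewrite mulr1.
  have -> : 1 - clampI s - (1 - clampI t) = clampI t - clampI s by ring.
  by rewrite ler_wpM2l// (le_trans zB)// ler_pdivrMr// mul1r ler1n.
have nvc : continuous (fun t => rc (normc (v t)) : C^o).
  move=> t; apply/cvg_normcP => e e0.
  have /cvg_normcP /(_ e e0) := vc t; apply: filterS => s; apply: le_lt_trans.
  have := normc_triangle (v t) (v s) 0; have := normc_triangle (v s) (v t) 0.
  rewrite !subr0 (normcB (v t)) rcB ler_norml => le1 le2.
  by apply/andP; split; lra.
exists (fun t => v t * (rc (normc (v t)))^-1); split.
- move=> t; exact: cvgM (vc t) (continuous_inv nvc nv0 (x := t)).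
- by move=> t; rewrite normcM normcV normc_real ?normc_ge0// mulfV// gt_eqF.
- move=> t t0; have vz : v t = z.
    rewrite /v [clampI t](congr1 val (toI0 t0)) /= subr0.
    by rewrite [rc 1]rmorph1 mul1r addrC subrK.
  by rewrite vz z1 [rc 1]rmorph1 invr1 mulr1.
- move=> t t1; have vz : v t = 1.
    by rewrite /v [clampI t](congr1 val (toI1 t1)) /= subrr [rc 0]rmorph0 mul0r addr0.
  by rewrite vz normc1 [rc 1]rmorph1 invr1 mulr1.
- move=> t; apply: le_trans (normc_triangle _ (v t) _) _.
  rewrite mulr_natl mulr2n lerD//.
  have -> : v t * (rc (normc (v t)))^-1 - v t =
      v t * (rc (normc (v t)))^-1 * (rc 1 - rc (normc (v t))).
    by rewrite [rc 1]rmorph1 mulrBr mulr1 -mulrA mulVf// mulr1.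
  rewrite !normcM normcV normc_real ?normc_ge0// mulfV ?gt_eqF// mul1r rcB.
  have := normc_triangle (v t) 1 0; have := normc_triangle 1 (v t) 0.
  rewrite !subr0 normc1 (normcB 1) => le1 le2; apply: le_trans (vB t).
  by rewrite ler_norml; apply/andP; split; lra.
Qed.

Lemma normc_mxmul_le (A B : Mn) (a b : R) :
  (forall i j, normc (A i j) <= a) -> (forall i j, normc (B i j) <= b) ->
  forall i j, normc ((A * B) i j) <= n%:R * (a * b).
Proof.
move=> Aa Bb i j; rewrite mxE; apply: le_trans (normc_sum _ _ _) _.
have -> : n%:R * (a * b) = \sum_(k < n) a * b.
  by rewrite sumr_const card_ord mulr_natl.
by apply: ler_sum => k _; rewrite normcM ler_pM ?normc_ge0.
Qed.

(** The tolerance d must be uniform in [U] and [V], so that it can be fixed before the pair of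
    unitaries is known. *)
Lemma unitary_path (e : R) : 0 < e -> exists2 d, 0 < d &
  forall U V : Mn, unitary U -> unitary V -> mxclose d U V ->
  exists W : R -> Mn, [/\ continuous W, forall t, unitary (W t),
    forall t, t <= 0 -> W t = U, forall t, 1 <= t -> W t = V &
    forall t, mxclose e (W t) V].
Proof.
move=> e0; pose N : R := n%:R; have N0 : 0 <= N by rewrite ler0n.
(* Each matrix product costs a factor N entrywise. Three products bound the eigenvalues of V^* U - 1
   by N^3 d, which must be at most 1/2 for [circle_path]; doubling and three more products give 2
   N^6 d, which must be below e. Both N^3 and N^6 are at most c^2. *)
pose c := 1 + N ^+ 3.
have N3 : 0 <= N ^+ 3 by rewrite exprn_ge0.
have c1 : 1 <= c by rewrite lerDl.
have c2 : 0 < c ^+ 2 by rewrite exprn_gt0// (lt_le_trans ltr01).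
pose d := Num.min (1 / 2) (e / 4) / c ^+ 2.
have m0 : 0 < Num.min (1 / 2) (e / 4) by rewrite lt_min !divr_gt0.
have dc2 : d * c ^+ 2 = Num.min (1 / 2) (e / 4) by rewrite mulfVK// gt_eqF.
have d0 : 0 < d by rewrite divr_gt0.
have le1 : N ^+ 3 * d <= 1 / 2.
  apply: le_trans (_ : c ^+ 2 * d <= _); last by rewrite mulrC dc2 ge_min lexx.
  by rewrite ler_pM2r// /c; nra.
have le2 : N ^+ 3 * (2 * (N ^+ 3 * d)) < e.
  have : c ^+ 2 * d <= e / 4 by rewrite mulrC dc2 ge_min lexx orbT.
  have : N ^+ 3 * N ^+ 3 * d <= c ^+ 2 * d by rewrite ler_pM2r// /c; nra.
  nra.
exists d => // U V uU uV UV.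
(* Diagonalize V^* U and move its eigenvalues to 1 along the unit circle. *)
pose Z := adjmx V * U.
have uZ : unitary Z by apply: unitaryM => //; exact: unitary_adj.
have adjE (A : Mn) : adjmx A = (map_mx Num.conj A^T)%R.
  by apply/matrixP => i j; rewrite !mxE.
have /orthomx_spectralP : (Z : 'M[C]_n) \is normalmx.
  by apply/normalmxP; rewrite -adjE; rewrite [LHS]uZ; exact/esym/unitary_adjK.
set P : Mn := spectralmx Z; set z := spectral_diag Z => ZE.
have uP : unitary P.
  by rewrite /unitary adjE; exact/unitarymxP/spectral_unitarymx.
have {}ZE : Z = adjmx P * diag_mx z * P.
  rewrite [LHS]ZE adjE; congr (_ * _ * _).
  exact/invmx_unitary/spectral_unitarymx.
have PP := unitary_adjK uP.
have assoc (S : pzRingType) (p q a : S) : p * q = 1 -> p * (q * a * p) * q = a.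
  by move=> pq; rewrite -!mulrA pq mulr1 mulrA pq mul1r.
have zE : diag_mx z = P * Z * adjmx P by rewrite ZE assoc.
have adj_le1 (A : Mn) : unitary A -> forall i j, normc (adjmx A i j) <= 1.
  by move=> uA i j; apply: unitary_entry_le1; exact: unitary_adj.
have Z1 i j : normc ((Z - 1) i j) <= N * d.
  have -> : Z - 1 = adjmx V * (U - V) by rewrite mulrBr (unitary_adjK uV).
  rewrite -[d]mul1r; apply: normc_mxmul_le; first exact: adj_le1.
  by move=> k l; rewrite !mxE; exact/ltW/UV.
have z1 k : normc (z 0 k - 1) <= N ^+ 3 * d.
  have -> : z 0 k - 1 = (P * (Z - 1) * adjmx P) k k.
    rewrite mulrBr mulrBl mulr1 -zE [P * adjmx P]uP.
    by rewrite mxE [X in _ = X + _]mxE [X in _ = _ + X]mxE [X in _ = _ - X]mxE eqxx mulr1n.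
  have -> : N ^+ 3 * d = N * ((N * (1 * (N * d))) * 1) by ring.
  apply: normc_mxmul_le; last exact: adj_le1.
  by apply: normc_mxmul_le => // i j; exact: unitary_entry_le1.
have zn k : normc (z 0 k) = 1.
  have : diag_mx z * adjmx (diag_mx z) = 1 :> Mn.
    by rewrite zE; apply: unitaryM; [exact: unitaryM|exact: unitary_adj].
  move/matrixP => /(_ k k); rewrite mxE (bigD1 k)//= big1 => [|l lk]; last first.
    by rewrite !mxE eq_sym (negPf lk) mulr0n mul0r.
  rewrite addr0 !mxE eqxx !mulr1n -normCK normrE -rmorphXn /= => /complexI /eqP.
  by rewrite sqrp_eq1 ?normc_ge0// => /eqP.
have [w wP] := choice (fun k => circle_path (zn k) (le_trans (z1 k) le1)).
pose D t : Mn := diag_mx (\row_k w k t).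
have wn k s : normc (w k s) = 1 by have [] := wP k.
have uD t : unitary (D t).
  rewrite /unitary /D; apply/matrixP => i j; rewrite [LHS]mxE (bigD1 i)//= big1 => [|l li].
    rewrite addr0 !mxE eqxx mulr1n; case: eqVneq => [<-|ij].
      by rewrite mulr1n -normCK normrE wn rmorph1 expr1n.
    by rewrite mulr0n rmorph0 mulr0.
  by rewrite !mxE eq_sym (negPf li) mulr0n mul0r.
(* At time 0 the bracket is Z = V^* U, so the product is U; at time 1 it is 1. *)
exists (fun t => V * (adjmx P * D t * P)); split.
- move=> t; apply: cvg_mxmul; first exact: cvg_cst.
  apply: cvg_mxmul; last exact: cvg_cst.
  apply: cvg_mxmul; first exact: cvg_cst.
  apply/cvg_mxP => i j; rewrite !mxE; under eq_fun do rewrite !mxE.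
  case: eqVneq => [->|_]; last by apply: cvg_cst.
  rewrite mulr1n; under eq_fun do rewrite mulr1n.
  by have [wc _ _ _ _] := wP j; exact: wc.
- move=> t; apply: unitaryM => //; apply: unitaryM => //; apply: unitaryM => //.
  exact: unitary_adj.
- move=> t t0; have -> : D t = diag_mx z.
    congr diag_mx; apply/rowP => k; rewrite mxE.
    by have [_ _ w0 _ _] := wP k; rewrite w0.
  by rewrite -ZE /Z mulrA uV mul1r.
- move=> t t1; have -> : D t = 1.
    rewrite -[RHS]diag_const_mx; congr diag_mx; apply/rowP => k; rewrite !mxE.
    by have [_ _ _ w1 _] := wP k; rewrite w1.
  by rewrite mulr1 PP mulr1.
- move=> t i j.
  have -> : (V * (adjmx P * D t * P)) i j - V i j =
      (V * (adjmx P * (D t - 1) * P)) i j.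
    by rewrite mulrBr mulrBl mulr1 PP mulrBr mulr1 [RHS]mxE [X in _ = _ + X]mxE.
  apply: le_lt_trans le2.
  set B := 2 * (N ^+ 3 * d).
  have -> : N ^+ 3 * B = N * (1 * (N * ((N * (1 * B)) * 1))) by ring.
  apply: normc_mxmul_le; first by move=> k l; exact: unitary_entry_le1.
  apply: normc_mxmul_le; last by move=> k l; exact: unitary_entry_le1.
  apply: normc_mxmul_le; first exact: adj_le1.
  move=> k l; rewrite !mxE; case: eqVneq => [_|_]; last first.
    rewrite !mulr0n subrr normc0 /B.
    by apply: mulr_ge0 => //; apply: mulr_ge0 => //; exact: ltW.
  rewrite !mulr1n; have [_ _ _ _ wk] := wP k.
  by apply: le_trans (wk t) _; rewrite ler_pM2l.
Qed.

End unitary_paths.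

(** * Short paths of homomorphisms *)

Section homomorphism_paths.
Variables (R : realType) (n : nat) (X : topologicalType).
Local Notation C := R[i].
Local Notation Mn := 'M[C^o]_n.
Implicit Types (c h : contC R X -> Mn) (F : set (contC R X)) (e : R).

(* Paths are parametrized by R and constant outside [0, 1], so that they can be
   glued by adding them up. *)
Definition hom_path F e c h0 h1 := exists H : R -> contC R X -> Mn,
  [/\ forall t, unital_star_homM (H t),
      forall f, continuous (fun t => H t f : Mn),
      forall t, t <= 0 -> H t = h0, forall t, 1 <= t -> H t = h1 &
      forall t f, F f -> mxclose e (H t f) (c f)].

Lemma hom_path_sym F e c h0 h1 : hom_path F e c h0 h1 -> hom_path F e c h1 h0.
Proof.
move=> [H [Hh Hc H0 H1 He]]; exists (fun t => H (1 - t)); split.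
- by move=> t; exact: Hh.
- move=> f t; apply: (@cvg_comp _ _ _ (fun t => 1 - t) (fun t => H t f)).
    by apply: cvgB; [exact: cvg_cst|exact: cvg_id].
  exact: Hc.
- by move=> t t0; apply: H1; lra.
- by move=> t t1; apply: H0; lra.
- by move=> t f Ff; exact: He.
Qed.

Lemma affine_continuous (a b : R) : continuous (fun t : R => a * t + b).
Proof.
move=> t; apply: cvgD; last exact: cvg_cst.
by apply: cvgM; [exact: cvg_cst|exact: cvg_id].
Qed.

(** The expression [H1 t + H2 t - h] is continuous without any pasting argument, and at each t one
    of the summands cancels against [h], so the value is again a homomorphism. *)
Lemma glue_paths (H1 H2 : R -> contC R X -> Mn) (s : R) h :
  (forall t, unital_star_homM (H1 t)) -> (forall t, unital_star_homM (H2 t)) ->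
  (forall f, continuous (fun t => H1 t f : Mn)) ->
  (forall f, continuous (fun t => H2 t f : Mn)) ->
  (forall t, s <= t -> H1 t = h) -> (forall t, t <= s -> H2 t = h) ->
  exists H : R -> contC R X -> Mn,
    [/\ forall t, unital_star_homM (H t),
        forall f, continuous (fun t => H t f : Mn),
        forall t, t <= s -> H t = H1 t & forall t, s <= t -> H t = H2 t].
Proof.
move=> H1h H2h H1c H2c H1s H2s.
pose H t f : Mn := H1 t f + (H2 t f + - 1 *: h f).
have Hl t : t <= s -> H t = H1 t.
  by move=> ts; apply/funext => f; rewrite /H H2s// scaleN1r subrr addr0.
have Hr t : s <= t -> H t = H2 t.
  by move=> ts; apply/funext => f; rewrite /H H1s// scaleN1r addrC subrK.
exists H; split; [| |exact: Hl|exact: Hr].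
  by move=> t; have [/Hl ->|/ltW /Hr ->] := leP t s; [exact: H1h|exact: H2h].
move=> f t; apply: cvg_mxD; first exact: H1c.
by apply: cvg_mxD; [exact: H2c|exact: cvg_cst].
Qed.

Lemma hom_path_trans F e c h1 h0 h2 :
  hom_path F e c h0 h1 -> hom_path F e c h1 h2 -> hom_path F e c h0 h2.
Proof.
move=> [H [Hh Hc H0 H1 He]] [K [Kh Kc K0 K1 Ke]].
have [||||L [Lh Lc Ll Lr]] := @glue_paths (fun t => H (2 * t + 0))
  (fun t => K (2 * t + -1)) (1 / 2) h1 (fun t => Hh _) (fun t => Kh _).
- move=> f t; apply: (@cvg_comp _ _ _ (fun t => 2 * t + 0) (fun t => H t f)).
    exact: affine_continuous.
  exact: Hc.
- move=> f t; apply: (@cvg_comp _ _ _ (fun t => 2 * t + -1) (fun t => K t f)).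
    exact: affine_continuous.
  exact: Kc.
- by move=> t ts; apply: H1; lra.
- by move=> t ts; apply: K0; lra.
exists L; split; [exact: Lh|exact: Lc| | |].
- by move=> t t0; rewrite Ll ?H0//; lra.
- by move=> t t0; rewrite Lr ?K1//; lra.
- by move=> t f Ff; have [/Ll ->|/ltW /Lr ->] := leP t (1 / 2); [exact: He|exact: Ke].
Qed.

Lemma hom_path_recenter F e e' c c' h0 h1 : hom_path F e c h0 h1 ->
  (forall f, F f -> mxclose e' (c f) (c' f)) -> hom_path F (e + e') c' h0 h1.
Proof.
move=> [H [Hh Hc H0 H1 He]] cc'; exists H.
split; [exact: Hh|exact: Hc|exact: H0|exact: H1|] => t f Ff.
by apply: mxclose_trans (cc' _ Ff); exact: He.
Qed.

(** Continuity of [diag_hom] at one pair, made explicit: boxes around the pair generate a filter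
    along which [cvg_diag_hom] applies. *)
Lemma diag_hom_near F e (U0 : Mn) (x0 : 'I_n -> X) : finite_set F -> 0 < e ->
  exists d (V : 'I_n -> set X), [/\ 0 < d, forall k, nbhs (x0 k) (V k) &
    forall U x, mxclose d U U0 -> (forall k, V k (x k)) ->
      forall f, F f -> mxclose e (diag_hom U x f) (diag_hom U0 x0 f)].
Proof.
move=> Ff e0.
pose D := [set dV : R * ('I_n -> set X) | 0 < dV.1 /\ forall k, nbhs (x0 k) (dV.2 k)].
pose box (dV : R * ('I_n -> set X)) :=
  [set p : Mn * ('I_n -> X) | mxclose dV.1 p.1 U0 /\ forall k, dV.2 k (p.2 k)].
have BF : Filter (filter_from D box).
  apply: filter_from_filter; first by exists (1, fun=> setT); split=> //= k; exact: filterT.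
  move=> [d V] [d' V'] [/= d0 Vn] [/= d0' Vn'].
  exists (Num.min d d', fun k => V k `&` V' k).
    by split=> /= [|k]; [rewrite lt_min d0|exact: filterI].
  move=> p [/= pU pV]; split; split=> /=.
  - by apply: mxclose_le pU; rewrite ge_min lexx.
  - by move=> k; have [] := pV k.
  - by apply: mxclose_le pU; rewrite ge_min lexx orbT.
  - by move=> k; have [] := pV k.
have : \forall p \near filter_from D box, forall f, F f ->
    mxclose e (diag_hom p.1 p.2 f) (diag_hom U0 x0 f).
  apply: near_finite_set => // f _.
  have /cvg_mxcloseP : (fun p => diag_hom p.1 p.2 f) @ filter_from D box -->
      diag_hom U0 x0 f.
    apply: (@cvg_diag_hom R n X _ _ _ fst snd).
      apply/cvg_mxcloseP => d d0; exists (d, fun=> setT).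
        by split=> //= k; exact: filterT.
      by move=> p [].
    (* A box that constrains only the k-th point. *)
    move=> k W Wx; exists (1, fun j => [set y | j = k -> W y]).
      split=> //= j; have [->|jk] := eqVneq j k.
        by apply: filterS Wx => y Wy _.
      by apply: filterE => y /eqP; rewrite (negPf jk).
    by move=> p [_ pV]; exact: pV.
  exact.
move=> [[d V] [/= d0 Vn] dV]; exists d, V; split=> // U x Ud xV.
exact: (dV (U, x)).
Qed.

(** Path connected neighbourhoods inside those of [diag_hom_near] keep the moving points where the
    estimate holds, while [unitary_path] keeps the moving unitary within d of [U0]. *)
Lemma diag_hom_local_path F e (U0 : Mn) (x0 : 'I_n -> X) :
  locally_path_connected R X -> unitary U0 -> finite_set F -> 0 < e ->
  exists d (V : 'I_n -> set X), [/\ 0 < d, forall k, nbhs (x0 k) (V k) &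
    forall U x, unitary U -> mxclose d U U0 -> (forall k, V k (x k)) ->
      hom_path F e (diag_hom U0 x0) (diag_hom U x) (diag_hom U0 x0)].
Proof.
move=> lpc uU0 Ff e0.
have [d [V [d0 Vn near0]]] := diag_hom_near U0 x0 Ff e0.
have [d' d0' dP] := unitary_path n d0.
have [W WP] := choice (fun k => lpc (x0 k) (V k) (Vn k)).
exists d', W; split=> // [k|U x uU UU0 Wx].
  by have [oW Wx _ _] := WP k; exact: open_nbhs_nbhs.
have [u [uc uu u0 u1 ud]] := dP U U0 uU uU0 UU0.
have yP k : exists y : R -> X, [/\ continuous y, forall t, V k (y t),
    forall t, t <= 0 -> y t = x k & forall t, 1 <= t -> y t = x0 k].
  have [oW Wx0 WV Wc] := WP k; have [p pW] := Wc _ _ (Wx k) Wx0.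
  exists (p \o @toI R); split.
  - move=> t; apply: (@cvg_comp _ _ _ (@toI R) p); first exact: toI_continuous.
    exact: cts_fun.
  - by move=> t; apply/WV/pW; exists (toI t).
  - by move=> t t0; rewrite /= toI0//; exact: path_zero.
  - by move=> t t1; rewrite /= toI1//; exact: path_one.
have [y {}yP] := choice yP.
exists (fun t => diag_hom (u t) (fun k => y k t)); split.
- by move=> t; exact: diag_hom_unital_star_hom.
- move=> f t; apply: (@cvg_diag_hom R n X _ _ _ u (fun t k => y k t)); first exact: uc.
  by move=> k; have [yc _ _ _] := yP k; exact: yc.
- move=> t t0; rewrite (u0 _ t0); have -> // : (fun k => y k t) = x.
  by apply/funext => k; have [_ _ y0 _] := yP k; rewrite y0.
- move=> t t1; rewrite (u1 _ t1); have -> // : (fun k => y k t) = x0.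
  by apply/funext => k; have [_ _ _ y1] := yP k; rewrite y1.
- move=> t f Ff'; apply: (near0 _ _ (ud t) _ f Ff') => k.
  by have [_ yV _ _] := yP k.
Qed.

Lemma close_homs_path F e :
  compact [set: X] -> locally_path_connected R X -> finite_set F -> 0 < e ->
  exists d G, [/\ 0 < d, finite_set G & forall h0 h1,
    unital_star_homM h0 -> unital_star_homM h1 ->
    (forall f, G f -> mxclose d (h0 f) (h1 f)) -> hom_path F e h0 h0 h1].
Proof.
move=> cX lpc Ff e0; apply: contrapT => no.
(* Counterexamples are recorded by representing pairs, because compactness and local paths are
   available there. *)
pose T := ((Mn * ('I_n -> X)) * (Mn * ('I_n -> X)))%type.
pose dh (p : Mn * ('I_n -> X)) := diag_hom p.1 p.2.
pose S (d : R) (G : set (contC R X)) := [set p : T | [/\ unitary p.1.1,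
  unitary p.2.1, forall f, G f -> mxclose d (dh p.1 f) (dh p.2 f) &
  ~ hom_path F e (dh p.1) (dh p.1) (dh p.2)]].
have [d d' G G' dd' GG' p [p1 p2 pc pn]|d G d0 Gfin|A [UA AS]] :=
  @finitary_ultrafilter R _ _ S.
- by split=> // f /GG' Gf; exact: mxclose_le dd' (pc _ Gf).
- apply: contrapT => S0; apply: no; exists d, G; split=> // h0 h1 hh0 hh1 hc.
  apply: contrapT => hp; apply: S0.
  have [U [x [uU hU]]] := unital_star_hom_diag cX hh0.
  have [V [y [uV hV]]] := unital_star_hom_diag cX hh1.
  exists ((U, x), (V, y)); split=> //=; rewrite /dh /=.
    by move=> f Gf; rewrite -hU -hV; exact: hc.
  by rewrite -hU -hV.
have [|U [x [uU AU Ax]]] := @ultra_diag_cvg R n X _ A (fun p => p.1.1) (fun p => p.1.2) UA cX.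
  by apply: filterS (AS 1 set0 ltr01 (finite_set0 _)) => p [].
have [|V [y [uV AV Ay]]] := @ultra_diag_cvg R n X _ A (fun p => p.2.1) (fun p => p.2.2) UA cX.
  by apply: filterS (AS 1 set0 ltr01 (finite_set0 _)) => p [].
have cvg1 f : (fun p => dh p.1 f) @ A --> diag_hom U x f.
  exact: (@cvg_diag_hom R n X _ A _ (fun p => p.1.1) (fun p => p.1.2)).
have cvg2 f : (fun p => dh p.2 f) @ A --> diag_hom V y f.
  exact: (@cvg_diag_hom R n X _ A _ (fun p => p.2.1) (fun p => p.2.2)).
(* The pairs (U, x) and (V, y) themselves may differ; only the homomorphisms coincide. *)
have same : diag_hom U x = diag_hom V y.
  apply/funext => f; apply: (@cvg_mx_unique R _ A _ n n (fun p => dh p.1 f) _ _ (cvg1 f)).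
  apply/cvg_mxcloseP => d d0.
  have d20 : 0 < d / 2 by rewrite divr_gt0.
  have /cvg_mxcloseP /(_ _ d20) := cvg2 f.
  apply: filterS2 (AS _ [set f] d20 (finite_set1 _)) => p [_ _ pc _] p2.
  by rewrite [d]splitr; apply: mxclose_trans p2; exact: pc.
have e20 : 0 < e / 2 by rewrite divr_gt0.
have [d [W [d0 Wn WP]]] := diag_hom_local_path x lpc uU Ff e20.
have [d' [W' [d0' Wn' WP']]] := diag_hom_local_path y lpc uV Ff e20.
have near1 : \forall p \near A, forall k, W k (p.1.2 k).
  by apply: filter_forall => k; exact: Ax.
have near2 : \forall p \near A, forall k, W' k (p.2.2 k).
  by apply: filter_forall => k; exact: Ay.
move/cvg_mxcloseP: AU => /(_ _ d0) AU; move/cvg_mxcloseP: AV => /(_ _ d0') AV.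
have [p [[[u1 u2 _ pn] [p1 p2]] [U1 U2]]] := filter_ex (filterI (filterI
  (AS 1 set0 ltr01 (finite_set0 _)) (filterI near1 near2)) (filterI AU AV)).
have path1 := WP _ _ u1 U1 p1; have path2 := WP' _ _ u2 U2 p2.
rewrite -same in path2.
have path12 := hom_path_trans path1 (hom_path_sym path2).
(* The path is within e/2 of the common limit, and so is its starting point, whence distance at most
   e from that point. *)
apply: pn; rewrite [e]splitr; apply: (hom_path_recenter path12) => f Ff'.
by apply: mxclose_sym; have [H [_ _ H0 _ He]] := path1; have := He 0 f Ff'; rewrite (H0 0 (lexx 0)).
Qed.

End homomorphism_paths.

(** * Concatenation over a grid of [0, 1] *)

Section concatenation.
Variables (R : realType) (n : nat).
Local Notation C := R[i].
Local Notation Mn := 'M[C^o]_n.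

(** Phrased as a property of all small d, so that finitely many functions can share one d. *)
Lemma contM_unif_continuous (f : contM R n) (e : R) : 0 < e ->
  \forall d \near 0^'+, forall t, `[0, 1]%classic t -> forall s, `|s - t| < d ->
    mxclose e (f (toI s)) (f (toI t)).
Proof.
move=> e0.
have fc t : (fun s : R => f (toI s) : Mn) @ t --> (f (toI t) : Mn).
  apply: (@cvg_comp _ _ _ (@toI R) f); first exact: toI_continuous.
  exact: cts_fun.
pose P (d : R) t := forall s, `|s - t| < d -> mxclose e (f (toI s)) (f (toI t)).
have /compact_near_coveringP /(_ R 0^'+ P _) := @segment_compact R 0 1.
apply=> t _.
have e20 : 0 < e / 2 by rewrite divr_gt0.
have /cvg_mxcloseP /(_ _ e20) /nbhs_ballP[r /= r0 rP] := fc t.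
have r20 : 0 < r / 2 by rewrite divr_gt0.
exists (ball t (r / 2), [set d | d < r / 2]).
  by split; [exact: nbhsx_ballx|exact: nbhs_right_lt].
move=> [u d] [/= tu dr] s su.
rewrite [e]splitr; apply: (@mxclose_trans _ _ _ _ _ (f (toI t))).
  apply: rP; rewrite /ball /= [r]splitr -[t - s](subrKA u) addrC.
  apply: le_lt_trans (ler_normD _ _) _; rewrite ltrD//.
  by rewrite distrC (lt_trans su).
apply: mxclose_sym; apply: rP; apply: lt_le_trans tu _.
by rewrite ler_pdivrMr// mulr_natr mulr2n lerDl ltW.
Qed.

Variable X : topologicalType.

(** The grid has unit spacing here and is rescaled later. The index is allowed to be [N] so that the
    induction can start at N = 0, where the only point t = 0 belongs to j = 0. *)
Lemma hom_path_chain (F : set (contC R X)) (e : R) (g : nat -> contC R X -> Mn) N :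
  0 < e -> unital_star_homM (g 0%N) ->
  (forall j, (j < N)%N -> hom_path F e (g j) (g j) (g j.+1)) ->
  exists H : R -> contC R X -> Mn, [/\ forall t, unital_star_homM (H t),
    forall f, continuous (fun t => H t f : Mn),
    forall t, t <= 0 -> H t = g 0%N, forall t, N%:R <= t -> H t = g N &
    forall t, 0 <= t <= N%:R -> exists j, [/\ (j <= N)%N, j%:R <= t <= j.+1%:R &
      forall f, F f -> mxclose e (H t f) (g j f)]].
Proof.
move=> e0 g0h; elim: N => [_|N IH gP].
  exists (fun=> g 0%N); split=> [//|f t|//|//|t]; first exact: cvg_cst.
  move=> /andP[t0 t1]; exists 0%N; split=> //.
    by rewrite t0 (le_trans t1)// ler_nat.
  by move=> f _; exact: mxclosexx.
have [j jN|H [Hh Hc H0 HN Hg]] := IH; first by apply: gP; rewrite ltnW.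
have [K [Kh Kc K0 K1 Ke]] := gP N (ltnSn N).
have [|||L [Lh Lc Ll Lr]] := @glue_paths _ _ _ H (fun t => K (1 * t + - N%:R)) N%:R (g N)
  Hh (fun t => Kh _) Hc.
- move=> f t; apply: (@cvg_comp _ _ _ (fun t => 1 * t + - N%:R) (fun t => K t f)).
    exact: affine_continuous.
  exact: Kc.
- exact: HN.
- by move=> t tN; apply: K0; rewrite mul1r subr_le0.
exists L; split; [exact: Lh|exact: Lc| | |].
- by move=> t t0; rewrite Ll ?H0// (le_trans t0).
- move=> t; rewrite -natr1 => tN; rewrite Lr; last by lra.
  by apply: K1; lra.
- move=> t /andP[t0 tN]; have [tle|tlt] := leP t N%:R.
    have [|j [jN jt jP]] := Hg t; first by rewrite t0.
    by exists j; split=> //; [exact: leqW|rewrite Ll].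
  exists N; split; [exact: leqnSn|by rewrite tN ltW|].
  by move=> f Ff; rewrite (Lr _ (ltW tlt)); exact: Ke.
Qed.

Lemma hom_of_path (H : R -> contC R X -> Mn) (a : R) :
  (forall t, unital_star_homM (H t)) -> (forall f, continuous (fun t => H t f : Mn)) ->
  exists2 psi : contC R X -> contM R n, unital_star_homCM psi &
    forall f t, psi f t = H (a * val t) f.
Proof.
move=> Hh Hc.
have ac : continuous (fun t : unitI R => a * val t).
  have -> : (fun t : unitI R => a * val t) = (fun s => a * s + 0) \o val.
    by apply/funext => t /=; rewrite addr0.
  move=> t; apply: cvg_comp; first exact: (@valI_continuous R t).
  exact: affine_continuous.
have pc f : continuous (fun t : unitI R => H (a * val t) f : Mn).
  move=> t; apply: (@cvg_comp _ _ _ (fun t : unitI R => a * val t) (fun t => H t f)).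
    exact: ac.
  exact: Hc.
exists (fun f => mkcts (pc f)) => //; split.
- by move=> b f g; apply/continuousEP => t; have [hl _ _] := Hh (a * val t); exact: hl.
- split; first by apply/continuousEP => t; have [_ [h1 _] _] := Hh (a * val t); exact: h1.
  by move=> f g; apply/continuousEP => t; have [_ [_ hM] _] := Hh (a * val t); exact: hM.
- by move=> f; apply/continuousEP => t; have [_ _ hs] := Hh (a * val t); exact: hs.
Qed.

(** Nothing is assumed about how [h t] depends on t. Neighbouring grid values of h are within d on G
    by passing through phi: d/3 from h to phi at each end, and d/3 for the variation of phi over one
    step. *)
Lemma near_homs_path_approx (e d : R) (F G : set (contC R X))
    (phi : contC R X -> contM R n) (h : unitI R -> contC R X -> Mn) :
  0 < e -> 0 < d -> finite_set F -> finite_set G ->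
  (forall h0 h1 : contC R X -> Mn, unital_star_homM h0 -> unital_star_homM h1 ->
    (forall f, G f -> mxclose d (h0 f) (h1 f)) -> hom_path F (e / 3) h0 h0 h1) ->
  (forall t, unital_star_homM (h t)) ->
  (forall t f, F f -> mxclose (e / 3) (phi f t) (h t f)) ->
  (forall t f, G f -> mxclose (d / 3) (phi f t) (h t f)) ->
  exists psi : contC R X -> contM R n, [/\ unital_star_homCM psi,
    forall f t, F f -> mxclose e (phi f t) (psi f t),
    forall f, psi f (unitI0 R) = h (unitI0 R) f &
    forall f, psi f (unitI1 R) = h (unitI1 R) f].
Proof.
move=> e0 d0 Ff Gf hpath hh hF hG.
have e30 : 0 < e / 3 by rewrite divr_gt0.
have d30 : 0 < d / 3 by rewrite divr_gt0.
pose unif (m : R) f (r : R) := forall t, `[0, 1]%classic t -> forall s, `|s - t| < r ->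
  mxclose m (phi f (toI s)) (phi f (toI t)).
have uF : \forall r \near 0^'+, forall f, F f -> unif (e / 3) f r.
  by apply: near_finite_set => // f _; exact: contM_unif_continuous.
have uG : \forall r \near 0^'+, forall f, G f -> unif (d / 3) f r.
  by apply: near_finite_set => // f _; exact: contM_unif_continuous.
have r0s := @nbhs_right_gt R 0.
have [r rP] := @filter_ex _ (0 : R)^'+ (at_right_proper_filter 0) _ (filterI (filterI uF uG) r0s).
case: rP => -[{}uF {}uG] r0.
have [N0 rN] := filter_ex (near_infty_natSinv_lt (PosNum r0)); rewrite /= in rN.
set N := N0.+1 in rN.
have Npos : 0 < N%:R :> R by rewrite ltr0n.
have in01 j : (j <= N)%N -> `[0, 1]%classic (j%:R / N%:R : R).
  move=> jN; rewrite /= in_itv /= divr_ge0 ?ler0n//.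
  by rewrite ler_pdivrMr// mul1r ler_nat.
pose g j := h (toI (j%:R / N%:R)).
have [//|j jN|H [Hh Hc H0 H1 Hg]] := @hom_path_chain F (e / 3) g N e30.
  exact: hh.
  apply: hpath; [exact: hh|exact: hh|] => f Gf'.
  have -> : d = d / 3 + d / 3 + d / 3 by lra.
  apply: (@mxclose_trans _ _ _ _ _ (phi f (toI (j.+1%:R / N%:R)))); last exact: hG.
  apply: (@mxclose_trans _ _ _ _ _ (phi f (toI (j%:R / N%:R)))).
    by apply: mxclose_sym; exact: hG.
  apply: mxclose_sym; apply: uG => //; first by apply: in01; exact: ltnW.
  by rewrite -mulrBl -natrB// subSnn mul1r ger0_norm ?invr_ge0// ltW.
have [psi psih psiE] := hom_of_path N%:R Hh Hc.
exists psi; split=> //.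
- move=> f t Ff'; rewrite psiE.
  have /andP[t0 t1] : 0 <= val t <= 1 by have := valP t; rewrite inE /= in_itv.
  have [|j [jN /andP[jt tj] jP]] := Hg (N%:R * val t).
    by rewrite mulr_ge0 ?ler0n//= ler_piMr ?ler0n.
  (* The three errors: phi from t to the grid point on its left, phi against h there, and the
     connecting path against its starting point. *)
  have -> : e = e / 3 + e / 3 + e / 3 by lra.
  apply: (@mxclose_trans _ _ _ _ _ (g j f)); last by apply: mxclose_sym; exact: jP.
  apply: (@mxclose_trans _ _ _ _ _ (phi f (toI (j%:R / N%:R)))); last exact: hF.
  rewrite -{1}(toIK t); apply: uF => //; first exact: in01.
  have -> : val t - j%:R / N%:R = (N%:R * val t - j%:R) * N%:R^-1.
    by rewrite mulrBl mulrAC mulfV ?gt_eqF// mul1r.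
  rewrite normrM [X in _ * X]ger0_norm ?invr_ge0 ?ltW//.
  apply: le_lt_trans rN; apply: ler_piMl; first by rewrite invr_ge0 ltW.
  rewrite ler_norml.
  by move: tj; rewrite -natr1 => tj; apply/andP; split; lra.
- by move=> f; rewrite psiE mulr0 H0// /g mul0r toI0.
- by move=> f; rewrite psiE mulr1 H1// /g mulfV ?gt_eqF// toI1.
Qed.

End concatenation.

Theorem lemma5p1 (R : realType) (X : metricType R) (n : nat) (M : R)
    (Xcompact : compact [set: X]) (Xlpc : locally_path_connected R X)
    (n_ge1 : (1 <= n)%N) (M_gt0 : 0 < M) :
  forall (e : R) (F : set (contC R X)), 0 < e -> finite_set F ->
  exists (d : R) (G : set (contC R X)), [/\ 0 < d, finite_set G &
    forall phi : contC R X -> contM R n,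
      phi 1 = 1 ->
      (forall f, contC_norm f <= 1 -> contM_norm (phi f) <= M) ->
      (forall (a b : R[i]) (x y : contC R X),
         Normc.normc a <= 1 -> Normc.normc b <= 1 -> G x -> G y ->
         [/\ contM_norm (phi (a *: x + b *: y) - (a *: phi x + b *: phi y)) < d,
             contM_norm (phi (x * y) - phi x * phi y) < d &
             contM_norm (phi (starC x) - starCM (phi x)) < d]) ->
      let approximates (psi : contC R X -> contM R n) :=
        unital_star_homCM psi /\
        (forall f, F f -> contM_norm (phi f - psi f) < e) in
      let pi0 := @eval_at R n (unitI0 R) in
      let pi1 := @eval_at R n (unitI1 R) in
      [/\ exists psi, approximates psi,
          unital_star_homM (pi0 \o phi) ->
          exists psi, approximates psi /\ pi0 \o psi = pi0 \o phi &
          unital_star_homM (pi0 \o phi) -> unital_star_homM (pi1 \o phi) ->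
          exists psi, [/\ approximates psi, pi0 \o psi = pi0 \o phi &
                          pi1 \o psi = pi1 \o phi]]].
Proof.
move=> e F e0 Ff.
(* The added 1 makes n^2 [e1] strictly smaller than e. *)
pose e1 := e / (n%:R * n%:R + 1).
have n0 : 0 <= n%:R * n%:R :> R by rewrite mulr_ge0.
have e10 : 0 < e1 by rewrite divr_gt0// ltr_wpDl.
have e1e : n%:R * (n%:R * e1) < e.
  rewrite mulrA /e1 mulrA ltr_pdivrMr ?ltr_wpDl// [X in X < _]mulrC.
  by rewrite ltr_pM2l// ltrDl.
have e130 : 0 < e1 / 3 by rewrite divr_gt0.
have [d [G [d0 Gf hpath]]] := @close_homs_path R n X F _ Xcompact Xlpc Ff e130.
(* One homomorphism per t must be close to phi on F, for the conclusion, and on G, so that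
   neighbours can be joined. *)
pose m := Num.min (e1 / 3) (d / 3).
have m0 : 0 < m by rewrite lt_min e130 divr_gt0.
have FGf : finite_set (F `|` G) by rewrite finite_setU.
have [d' [G' [d'0 G'f near]]] :=
  @near_multiplicative_near_hom R n X M m _ Xcompact m0 FGf.
exists d', G'; split=> // phi phi1 phiM phinear approximates pi0 pi1.
(* Wherever phi at t is already a homomorphism it is kept as it is. A single psi then proves all
   three claims, since the chain takes the chosen values exactly at both endpoints. *)
have hP t : exists h : contC R X -> 'M[R[i]^o]_n, [/\ unital_star_homM h,
    forall f, (F `|` G) f -> mxclose m (phi f t) (h f) &
    unital_star_homM (@eval_at R n t \o phi) -> h = @eval_at R n t \o phi].
  have [hphi|nphi] := pselect (unital_star_homM (@eval_at R n t \o phi)).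
    by exists (@eval_at R n t \o phi); split=> // f _; exact: mxclosexx.
  have [||| h hh hF] := near (@eval_at R n t \o phi).
  - by rewrite /= phi1.
  - by move=> f /phiM fM i j; exact: contM_norm_le.
  - move=> a b x y a1 b1 Gx Gy; have [p1 p2 p3] := phinear a b x y a1 b1 Gx Gy.
    split; apply/mxclose_subP.
    + exact: (contM_norm_mxclose p1 t).
    + exact: (contM_norm_mxclose p2 t).
    + exact: (contM_norm_mxclose p3 t).
  by exists h; split=> // /nphi.
have [h {}hP] := choice hP.
have [|||psi [psih psiF psi0 psi1]] :=
  near_homs_path_approx (phi := phi) (h := h) e10 d0 Ff Gf hpath.
- by move=> t; have [] := hP t.
- move=> t f fF; have [_ ht _] := hP t.
  by apply: mxclose_le (ht f (or_introl fF)); rewrite ge_min lexx.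
- move=> t f fG; have [_ ht _] := hP t.
  by apply: mxclose_le (ht f (or_intror fG)); rewrite ge_min lexx orbT.
have psia : approximates psi.
  split=> // f fF; apply: le_lt_trans e1e; apply: le_contM_norm => t i j.
  have /mxclose_subP /(_ i j) := psiF f t fF.
  by rewrite [X in _ - X]mxE subr0 => /ltW; exact.
have end0 : unital_star_homM (pi0 \o phi) -> pi0 \o psi = pi0 \o phi.
  by have [_ _ h0] := hP (unitI0 R); move=> /h0 <-; apply/funext => f; exact: psi0.
have end1 : unital_star_homM (pi1 \o phi) -> pi1 \o psi = pi1 \o phi.
  by have [_ _ h1] := hP (unitI1 R); move=> /h1 <-; apply/funext => f; exact: psi1.
split; first by exists psi.
  by move=> /end0; exists psi.
by move=> /end0 ? /end1; exists psi.
Qed.
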